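(* For every point $x\in \mathcal{SG}\setminus V_0$ there exist an integer $k_0\ge 1$ and sets $B_k(x)$, $k\ge k_0$, such that each $B_k(x)$ is a $k$ level mean value neighborhood of $x$ (associated to some $k$-cell containing $x$ and not meeting $V_0$), and $\bigcap_{k\ge k_0}B_k(x)=\{x\}$.
   Context: Let $q_0,q_1,q_2$ be the vertices of an equilateral triangle in $\mathbb{R}^2$ and $F_i(z)=\frac12(z+q_i)$, $i=0,1,2$. The Sierpinski gasket $\mathcal{SG}$ is the unique nonempty compact set with $\mathcal{SG}=\bigcup_{i=0}^2F_i(\mathcal{SG})$. For a word $w=(w_1,\dots,w_m)\in\{0,1,2\}^m$ put $F_w=F_{w_1}\circ\cdots\circ F_{w_m}$; the set $C_w=F_w(\mathcal{SG})$ is an $m$-cell (of level $m=|w|$), with boundary points $F_wq_0,F_wq_1,F_wq_2$. Let $V_0=\{q_0,q_1,q_2\}$, $V_m=\bigcup_{|w|=m}F_w(V_0)$, and write $x\sim_m y$ if $x\neq y$ both lie in $F_w(V_0)$ for some $|w|=m$. Let $\mu$ be the self-similar probability measure on $\mathcal{SG}$ giving mass $3^{-m}$ to each $m$-cell. A continuous function $h:\mathcal{SG}\to\mathbb{R}$ is harmonic if $h(x)=\frac14\sum_{y\sim_m x}h(y)$ for every $m\ge1$ and every $x\in V_m\setminus V_0$. For a set $B$ of positive measure, $M_B(h)=\frac{1}{\mu(B)}\int_B h\,d\mu$. Let $C_w$ be a cell with $C_w\cap V_0=\emptyset$ and boundary points $p_i=F_wq_i$. Each $p_i$ lies in exactly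 one other cell of the same level, denoted $C_i$ (the neighbor of $C_w$ at $p_i$); let $D_w=C_w\cup C_0\cup C_1\cup C_2$. Let $\rho$ be the height of the equilateral triangle $F_w(\mathrm{conv}\{q_0,q_1,q_2\})$ (the size of $C_w$). For $c_i\in[0,1]$, let $u_i$ be the unit vector at $p_i$ pointing along the symmetry axis of the triangle of $C_i$ through $p_i$ into $C_i$, and let $E_i=\{z\in C_i:\langle z-p_i,u_i\rangle\le c_i\rho\}$ (the sub-triangle of $C_i$ cut off symmetrically by a line at distance $c_i\rho$ from $p_i$). Set $B(c_0,c_1,c_2)=C_w\cup E_0\cup E_1\cup E_2$ (so $B(0,0,0)=C_w$ up to the points $p_i$, and $B(1,1,1)=D_w$). For $x\in C_w$, a set $B=B(c_0,c_1,c_2)$ associated to $C_w$ is called a mean value neighborhood of $x$ associated to $C_w$ if $M_B(h)=h(x)$ for every harmonic function $h$; it is a $k$ level mean value neighborhood if $|w|=k$. *)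

(* Defs.v *)
From HB Require Import structures.
From mathcomp Require Import all_boot all_order all_algebra.
From mathcomp Require Import all_classical all_reals all_analysis.
Set Implicit Arguments. Unset Strict Implicit. Unset Printing Implicit Defensive.
Import Order.TTheory GRing.Theory Num.Theory.
Import numFieldNormedType.Exports.
Local Open Scope classical_set_scope.
Local Open Scope ring_scope.

Definition vadd {R : realType} (a b : R * R) : R * R := (a.1 + b.1, a.2 + b.2).
Definition vsub {R : realType} (a b : R * R) : R * R := (a.1 - b.1, a.2 - b.2).
Definition vscale {R : realType} (c : R) (a : R * R) : R * R := (c * a.1, c * a.2).
Definition dot {R : realType} (a b : R * R) : R := a.1 * b.1 + a.2 * b.2.
Definition vnorm {R : realType} (a : R * R) : R := Num.sqrt (dot a a).

Definition i0 : 'I_3 := @Ordinal 3 0 isT.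
Definition i1 : 'I_3 := @Ordinal 3 1 isT.
Definition i2 : 'I_3 := @Ordinal 3 2 isT.

Definition equilateral {R : realType} (q : 'I_3 -> R * R) : Prop :=
  (forall i j : 'I_3, i != j -> q i != q j) /\
  (forall i j k l : 'I_3, i != j -> k != l ->
      vnorm (vsub (q i) (q j)) = vnorm (vsub (q k) (q l))).

Definition Fmap {R : realType} (q : 'I_3 -> R * R) (i : 'I_3) (z : R * R) : R * R :=
  vscale (2^-1) (vadd z (q i)).

Definition Fw {R : realType} (q : 'I_3 -> R * R) (w : seq 'I_3) : R * R -> R * R :=
  foldr (fun i f => Fmap q i \o f) id w.

(* K is the Sierpinski gasket: the (unique) nonempty compact set with
   K = F_0(K) u F_1(K) u F_2(K). *)
Definition is_SG {R : realType} (q : 'I_3 -> R * R) (K : set (R * R)) : Prop :=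
  compact K /\ K !=set0 /\ K = \bigcup_(i in [set: 'I_3]) (Fmap q i @` K).

Definition cell {R : realType} (q : 'I_3 -> R * R) (K : set (R * R)) (w : seq 'I_3)
  : set (R * R) := Fw q w @` K.

Definition cellpts {R : realType} (q : 'I_3 -> R * R) (w : seq 'I_3) : seq (R * R) :=
  [seq Fw q w (q j) | j <- enum 'I_3].

Definition Vm {R : realType} (q : 'I_3 -> R * R) (m : nat) : set (R * R) :=
  [set z | exists (w : m.-tuple 'I_3) (j : 'I_3), z = Fw q w (q j)].

Definition neighbors {R : realType} (q : 'I_3 -> R * R) (m : nat) (x : R * R)
  : seq (R * R) :=
  undup [seq y <- flatten [seq cellpts q (val w) | w <- enum {: m.-tuple 'I_3}
                                                 & x \in cellpts q (val w)]
         | y != x].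

(* harmonic functions on SG (h is only relevant on K) *)
Definition harmonic {R : realType} (q : 'I_3 -> R * R) (K : set (R * R))
  (h : R * R -> R) : Prop :=
  {within K, continuous h} /\
  forall m : nat, (1 <= m)%N -> forall x, Vm q m x -> ~ range q x ->
    h x = 4^-1 * \sum_(y <- neighbors q m x) h y.

Definition selfsim {R : realType} (q : 'I_3 -> R * R) (K : set (R * R))
  (mu : {measure set (R * R) -> \bar R}) : Prop :=
  mu (~` K) = 0%E /\
  forall w : seq 'I_3, mu (cell q K w) = ((3%:R : R) ^- (size w))%:E.

Definition mean {R : realType} (mu : {measure set (R * R) -> \bar R})
  (B : set (R * R)) (h : R * R -> R) : R :=
  fine (\int[mu]_(z in B) (h z)%:E) / fine (mu B).

Definition height {R : realType} (q : 'I_3 -> R * R) (w : seq 'I_3) : R :=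
  Num.sqrt 3 / 2 * vnorm (vsub (Fw q w (q i0)) (Fw q w (q i1))).

Definition centroid {R : realType} (q : 'I_3 -> R * R) (v : seq 'I_3) : R * R :=
  vscale (3^-1) (vadd (Fw q v (q i0)) (vadd (Fw q v (q i1)) (Fw q v (q i2)))).

(* u_i: unit vector at p_i = F_w q_i along the symmetry axis of the triangle of
   the neighbouring cell C_v through its vertex p_i, pointing into C_v
   (i.e. towards the centroid of that triangle). *)
Definition axis {R : realType} (q : 'I_3 -> R * R) (w v : seq 'I_3) (i : 'I_3) : R * R :=
  let d := vsub (centroid q v) (Fw q w (q i)) in vscale (vnorm d)^-1 d.

Definition Ecut {R : realType} (q : 'I_3 -> R * R) (K : set (R * R))
  (w v : seq 'I_3) (i : 'I_3) (c : R) : set (R * R) :=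
  [set z | cell q K v z /\
           dot (vsub z (Fw q w (q i))) (axis q w v i) <= c * height q w].

Definition Bset {R : realType} (q : 'I_3 -> R * R) (K : set (R * R))
  (w : seq 'I_3) (v : 'I_3 -> seq 'I_3) (c : 'I_3 -> R) : set (R * R) :=
  cell q K w `|` \bigcup_(i in [set: 'I_3]) Ecut q K w (v i) i (c i).

(* B is a k level mean value neighborhood of x (associated to a k-cell C_w
   containing x with C_w n V_0 = empty). v i is the (unique) other k-cell
   containing p_i = F_w q_i. *)
Definition is_MVN {R : realType} (q : 'I_3 -> R * R) (K : set (R * R))
  (mu : {measure set (R * R) -> \bar R}) (x : R * R) (k : nat) (B : set (R * R))
  : Prop :=
  exists w : seq 'I_3,
    [/\ size w = k, cell q K w x, cell q K w `&` range q = set0 &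
    exists (v : 'I_3 -> seq 'I_3) (c : 'I_3 -> R),
      [/\ forall i, [/\ size (v i) = k, v i != w & cell q K (v i) (Fw q w (q i))],
          forall i, 0 <= c i <= 1,
          B = Bset q K w v c &
          forall h, harmonic q K h -> mean mu B h = h x]].

(* Main.v *)
(* Barycentric coordinates turn the set [E_i] into the part of the cell [C_i]
   where the coordinate at [p_i] is at least [t = 1 - c_i]. Its mass and the
   integrals of harmonic functions over it are governed by two continuous
   profiles [m] and [n], the solutions of a contracting functional equation, and
   harmonicity at [p_i] expresses the integral through the values of [h] at the
   vertices of [C_w] only: up to the factor 3^-|w|, it equals
   [(m + 3 n) h(p_i) - n (h(p_0) + h(p_1) + h(p_2))], with [m, n] taken at [t].
   Since [x] lies in [C_w], [h(x)] is a convex combination of the [h(p_i)] with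
   weights [a_i] independent of [h]. Hence the mean value property holds as soon
   as [m(t_i) + 3 n(t_i) = a_i S] where [S = 1 + sum_i m(t_i)]: summing over [i]
   then forces [sum_i n(t_i) = 1/3], which cancels the common term. Solving the
   first equations for [t_i] turns the second into a fixed-point equation for
   [S], to which the intermediate value theorem applies. *)
Require Import Defs.
From HB Require Import structures.
From mathcomp Require Import all_boot all_order all_algebra.
From mathcomp Require Import all_classical all_reals all_analysis.
From mathcomp Require Import ring lra.
Set Implicit Arguments. Unset Strict Implicit. Unset Printing Implicit Defensive.
Import Order.TTheory GRing.Theory Num.Theory.
Import numFieldNormedType.Exports.
Local Open Scope classical_set_scope.
Local Open Scope ring_scope.

(** * Geometry of the cells *)

Lemma I3_ind (P : 'I_3 -> Prop) : P i0 -> P i1 -> P i2 -> forall i, P i.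
Proof.
move=> p0 p1 p2 [[|[|[|//]]] lti].
- by rewrite (_ : Ordinal lti = i0)//; exact: val_inj.
- by rewrite (_ : Ordinal lti = i1)//; exact: val_inj.
- by rewrite (_ : Ordinal lti = i2)//; exact: val_inj.
Qed.

Lemma sum3 (V : nmodType) (f : 'I_3 -> V) :
  \sum_(i < 3) f i = f i0 + f i1 + f i2.
Proof.
rewrite !big_ord_recl big_ord0 addr0 addrA; congr (_ + _ + _); congr f;
  exact: val_inj.
Qed.

Section geometry.
Context {R : realType}.
Implicit Types (z p : R * R) (w v : seq 'I_3) (i j a b : 'I_3).
Variable q : 'I_3 -> R * R.

Lemma FwE w z : Fw q w z =
  (2^-1 ^+ size w * z.1 + (Fw q w (0, 0)).1,
   2^-1 ^+ size w * z.2 + (Fw q w (0, 0)).2).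
Proof.
elim: w => [|a w IH] /=; first by case: z => ? ? /=; congr (_, _); lra.
by rewrite IH /Fmap /vscale /vadd /= exprS; congr (_, _); ring.
Qed.

Lemma Fw_cat w v z : Fw q (w ++ v) z = Fw q w (Fw q v z).
Proof. by elim: w => //= a w ->. Qed.

Lemma Fw_inj w : injective (Fw q w).
Proof.
move=> z p; rewrite (FwE w z) (FwE w p) => -[/addIr h1 /addIr h2].
have s0 : (2^-1 ^+ size w : R) != 0 by rewrite expf_neq0// invr_eq0 pnatr_eq0.
by case: z p h1 h2 => ? ? [? ?] /= /(mulfI s0)-> /(mulfI s0)->.
Qed.

(** * Barycentric coordinates of the triangle *)

Definition sqside : R := dot (vsub (q i0) (q i1)) (vsub (q i0) (q i1)).

(* The barycentric coordinate of [z] at the vertex [q i]: one minus the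
   normalized distance from [q i] along the symmetry axis through [q i]. *)
Definition bary i z : R :=
  1 - 2 * dot (vsub z (q i)) (vsub (centroid q [::]) (q i)) / sqside.

Hypothesis qeq : equilateral q.

Lemma dot_ge0 z : 0 <= dot z z.
Proof. by rewrite /dot addr_ge0// -expr2 sqr_ge0. Qed.

Lemma sqsideE i j : i != j -> dot (vsub (q i) (q j)) (vsub (q i) (q j)) = sqside.
Proof.
move=> ij; have := qeq.2 i j i0 i1 ij isT; rewrite /vnorm => /eqP.
by rewrite eqr_sqrt ?dot_ge0// => /eqP.
Qed.

Lemma sqside_gt0 : 0 < sqside.
Proof.
rewrite lt_neqAle dot_ge0 andbT eq_sym; apply/eqP => q0.
have /negP := qeq.1 i0 i1 isT; apply.
move: q0; rewrite /sqside /dot /vsub /= -!expr2 => /eqP.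
rewrite paddr_eq0 ?sqr_ge0// !sqrf_eq0 !subr_eq0 => /andP[/eqP h1 /eqP h2].
by apply/eqP; move: h1 h2; case: (q i0) (q i1) => ? ? [? ?] /= -> ->.
Qed.

Let sideE : [/\ dot (vsub (q i0) (q i1)) (vsub (q i0) (q i1)) = sqside,
  dot (vsub (q i0) (q i2)) (vsub (q i0) (q i2)) = sqside &
  dot (vsub (q i1) (q i2)) (vsub (q i1) (q i2)) = sqside].
Proof. by split; apply: sqsideE. Qed.

(** Each value is a linear combination of the three squared side lengths, all equal to [sqside]. *)
Lemma dot_axis i j : dot (vsub (q j) (q i)) (vsub (centroid q [::]) (q i)) =
  if i == j then 0 else sqside / 2.
Proof.
case: sideE; rewrite /centroid /dot /vsub /vscale /vadd /=.
by elim/I3_ind: i; elim/I3_ind: j => /= h1 h2 h3; lra.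
Qed.

Lemma dot_axis_self i :
  dot (vsub (centroid q [::]) (q i)) (vsub (centroid q [::]) (q i)) = sqside / 3.
Proof.
case: sideE; rewrite /centroid /dot /vsub /vscale /vadd /=.
by elim/I3_ind: i => /= h1 h2 h3; lra.
Qed.

Lemma bary_vertex i j : bary i (q j) = (i == j)%:R.
Proof.
rewrite /bary dot_axis; have := sqside_gt0; case: eqVneq => _ l0.
  by rewrite mulr0 mul0r subr0.
by rewrite mulr0n; field; lra.
Qed.

Lemma bary_Fmap i a z : bary i (Fmap q a z) = (bary i z + (i == a)%:R) / 2.
Proof.
rewrite -(bary_vertex i a) /bary /dot /vsub /Fmap /vscale /vadd /=.
by have := sqside_gt0 => l0; field; lra.
Qed.

Lemma bary_sum z : \sum_i bary i z = 1.
Proof.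
have l0 := sqside_gt0; rewrite sum3 /bary.
suff -> : dot (vsub z (q i0)) (vsub (centroid q [::]) (q i0)) =
    sqside - dot (vsub z (q i1)) (vsub (centroid q [::]) (q i1))
    - dot (vsub z (q i2)) (vsub (centroid q [::]) (q i2)) by field; lra.
case: sideE; rewrite /centroid /dot /vsub /vscale /vadd /= => h1 h2 h3; lra.
Qed.

(** Equal coordinates make [z - p] orthogonal to the two edges at [q i0], which are linearly
    independent. *)
Lemma bary_inj z p : (forall i, bary i z = bary i p) -> z = p.
Proof.
have l0 := sqside_gt0 => zp.
have d i : dot (vsub z p) (vsub (centroid q [::]) (q i)) = 0.
  have : dot (vsub z (q i)) (vsub (centroid q [::]) (q i)) =
         dot (vsub p (q i)) (vsub (centroid q [::]) (q i)).
    have := zp i; rewrite /bary => /addrI/oppr_inj.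
    by move/(mulIf (invr_neq0 (lt0r_neq0 l0))) => h; lra.
  by rewrite /dot /vsub /= => h; lra.
pose e1 := vsub (q i1) (q i0); pose e2 := vsub (q i2) (q i0).
have h1 : dot (vsub z p) e1 = 0.
  by have := d i0; have := d i1; rewrite /e1 /dot /vsub /=; lra.
have h2 : dot (vsub z p) e2 = 0.
  by have := d i0; have := d i2; rewrite /e2 /dot /vsub /=; lra.
pose D := e1.1 * e2.2 - e1.2 * e2.1.
(* Lagrange's identity: the squared determinant of the edges is their Gram determinant. *)
have D2 : D ^+ 2 = 3 / 4 * sqside ^+ 2.
  have [k1 k2 k3] := sideE.
  have g1 : dot e1 e1 = sqside by rewrite -k1 /e1 /dot /vsub /=; ring.
  have g2 : dot e2 e2 = sqside by rewrite -k2 /e2 /dot /vsub /=; ring.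
  have g3 : dot e1 e2 = sqside / 2.
    by move: k1 k2 k3; rewrite /e1 /e2 /dot /vsub /=; lra.
  have -> : D ^+ 2 = dot e1 e1 * dot e2 e2 - dot e1 e2 ^+ 2.
    by rewrite /D /dot; ring.
  by rewrite g1 g2 g3; field.
have D0 : D != 0.
  by rewrite -sqrf_eq0 D2 mulf_neq0 ?sqrf_eq0 ?lt0r_neq0//; lra.
have y1 : D * (vsub z p).1 = 0.
  have -> : D * (vsub z p).1 = e2.2 * dot (vsub z p) e1 - e1.2 * dot (vsub z p) e2.
    by rewrite /D /dot; ring.
  by rewrite h1 h2 !mulr0 subr0.
have y2 : D * (vsub z p).2 = 0.
  have -> : D * (vsub z p).2 = e1.1 * dot (vsub z p) e2 - e2.1 * dot (vsub z p) e1.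
    by rewrite /D /dot; ring.
  by rewrite h1 h2 !mulr0 subr0.
move: y1 y2 => /eqP; rewrite mulf_eq0 (negPf D0) subr_eq0 /= => /eqP y1.
move=> /eqP; rewrite mulf_eq0 (negPf D0) subr_eq0 /= => /eqP.
by move: y1; case: (z) (p) => ? ? [? ?] /= -> ->.
Qed.

Definition triangle : set (R * R) := [set z | forall i, 0 <= bary i z].

Lemma triangle_vertex i : triangle (q i).
Proof. by move=> j; rewrite bary_vertex ler0n. Qed.

Lemma triangle_Fmap a z : triangle z -> triangle (Fmap q a z).
Proof. by move=> tz i; rewrite bary_Fmap divr_ge0// addr_ge0 ?ler0n//; exact: tz. Qed.

Lemma triangle_Fw w z : triangle z -> triangle (Fw q w z).
Proof. by move=> tz; elim: w => //= a w; exact: triangle_Fmap. Qed.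

Lemma triangle_eq_vertex i z : triangle z -> bary i z = 1 -> z = q i.
Proof.
move=> tz zi; apply: bary_inj => j; rewrite bary_vertex.
have := bary_sum z; rewrite sum3; move: (tz i0) (tz i1) (tz i2) zi.
by elim/I3_ind: i; elim/I3_ind: j => /=; lra.
Qed.

(** Comparing coordinates at [a] gives [bary a z + 1 = bary a p], which inside the triangle forces
    [bary a p = 1]; likewise at [b]. *)
Lemma Fmap_meet a b z p : a != b -> triangle z -> triangle p ->
  Fmap q a z = Fmap q b p -> z = q b /\ p = q a.
Proof.
move=> ab tz tp zp.
have ha : bary a z + 1 = bary a p.
  have := congr1 (bary a) zp; rewrite !bary_Fmap eqxx (negPf ab) /=; lra.
have hb : bary b z = bary b p + 1.
  have := congr1 (bary b) zp; rewrite !bary_Fmap eqxx eq_sym (negPf ab) /=; lra.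
have le1 j y : triangle y -> bary j y <= 1.
  move=> ty; have := bary_sum y; rewrite sum3.
  by move: (ty i0) (ty i1) (ty i2); elim/I3_ind: j; lra.
have := tz a; have := tp b; have := le1 a p tp; have := le1 b z tz => *.
by split; apply: triangle_eq_vertex => //; lra.
Qed.

Lemma Fmap_vertex a z i : triangle z -> Fmap q a z = q i -> a = i /\ z = q i.
Proof.
move=> tz e; have := congr1 (bary i) e; rewrite bary_Fmap bary_vertex eqxx.
case: (eqVneq i a) => [-> /= h|_ /= h].
  by split => //; apply: triangle_eq_vertex => //; lra.
have := bary_sum z; rewrite sum3.
move: (tz i0) (tz i1) (tz i2) h; clear e => t0 t1 t2 h hs; exfalso.
suff : (1 : R) <= 0 by rewrite ler10.
by elim/I3_ind: i h; lra.
Qed.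

(** By induction on the word: a corner is reached from subtriangle [i] alone, and there only from
    corner [i]. *)
Lemma Fw_vertex w j i : Fw q w (q j) = q i -> w = nseq (size w) i.
Proof.
elim: w => //= a w IH; have tw := triangle_Fw w (triangle_vertex j).
by move=> /(Fmap_vertex tw)[-> /IH {1}->].
Qed.

Lemma Fw_nseq n i : Fw q (nseq n i) (q i) = q i.
Proof.
elim: n => //= n ->; rewrite /Fmap /vscale /vadd.
by case: (q i) => ? ? /=; congr (_, _); lra.
Qed.

Lemma q_inj : injective q.
Proof.
move=> i j qij; apply/eqP; apply: contraT => /(qeq.1 i j).
by rewrite qij eqxx.
Qed.

(** Once the common prefix is stripped, [Fmap_meet] pins down the shared point, so two cells of one
    level cannot share two vertices. *)
Lemma Fw_common_vertex2 w v i j i' j' : size w = size v -> w != v ->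
  Fw q w (q i) = Fw q v (q i') -> Fw q w (q j) = Fw q v (q j') -> i = j.
Proof.
elim: w v => [|a w IH] [|b v] //= [] swv wv.
have tV u k := triangle_Fw u (triangle_vertex k).
have [ab|ab] := eqVneq a b.
  rewrite -ab => /(@Fw_inj [:: a]) h1 /(@Fw_inj [:: a]) h2.
  by apply: (IH v) h1 h2 => //; apply: contra wv => /eqP->; rewrite ab.
move=> /(Fmap_meet ab (tV _ _) (tV _ _))[h1 _].
move=> /(Fmap_meet ab (tV _ _) (tV _ _))[h2 _].
by apply: q_inj; apply: (@Fw_inj w); rewrite h1 h2.
Qed.

(** Where first letters differ, the shared point is a corner of each subtriangle and [Fw_vertex]
    determines the remaining letters; three different first letters would identify two corners. *)
Lemma Fw_common_vertex3 w v u i j k : size w = size v -> size u = size w ->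
  w != v -> Fw q w (q i) = Fw q v (q j) -> Fw q w (q i) = Fw q u (q k) ->
  u = w \/ u = v.
Proof.
elim: w v u => [|a w IH] [|b v] [|c u] //= [] swv [] suw wv.
have tV x y := triangle_Fw x (triangle_vertex y).
have [ab|ab] := eqVneq a b; have [ac|ac] := eqVneq a c.
- subst b c => /(@Fw_inj [:: a]) h1 /(@Fw_inj [:: a]) h2.
  case: (IH v u swv suw _ h1 h2) => [|->|->]; [|by left|by right].
  by apply: contra wv => /eqP->.
- subst b => /(@Fw_inj [:: a]) h1.
  move=> /(Fmap_meet ac (tV _ _) (tV _ _))[h2 _]; exfalso; move/negP: wv; apply.
  by rewrite (Fw_vertex h2) (Fw_vertex (esym (etrans (esym h2) h1))) swv.
- subst c => /(Fmap_meet ab (tV _ _) (tV _ _))[h1 _] /(@Fw_inj [:: a]) h2.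
  by left; rewrite (Fw_vertex h1) (Fw_vertex (etrans (esym h2) h1)) suw.
- move=> h1; move: (h1) => /(Fmap_meet ab (tV _ _) (tV _ _))[h1a h1b].
  rewrite h1 => h2; have [bc|bc] := eqVneq b c.
    subst c; move: h2 => /(@Fw_inj [:: b]) h2.
    right; rewrite (Fw_vertex h1b) (Fw_vertex (etrans (esym h2) h1b)).
    by rewrite suw swv.
  move: h2 => /(Fmap_meet bc (tV _ _) (tV _ _))[h2 _].
  by move: ac; rewrite (q_inj (etrans (esym h1b) h2)) eqxx.
Qed.

Definition midpt a b : R * R := Fmap q a (q b).

Lemma midptC a b : midpt a b = midpt b a.
Proof. by rewrite /midpt /Fmap /vscale /vadd /= ![_ + (q b).1]addrC
  ![_ + (q b).2]addrC. Qed.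

Lemma neighbors_mem m (w : seq 'I_3) x y : (y \in neighbors q m x) <->
  y != x /\ exists u, [/\ size u = m, x \in cellpts q u & y \in cellpts q u].
Proof.
rewrite /neighbors mem_undup mem_filter; split.
  move=> /andP[-> /flattenP[s /mapP[u]]]; rewrite mem_filter => /andP[xu _] -> yu.
  by split => //; exists (val u); rewrite size_tuple.
move=> [-> [u [su xu yu]]] /=; apply/flattenP; exists (cellpts q u) => //.
apply/mapP; exists (tcast su (in_tuple u)); last by rewrite val_tcast.
by rewrite mem_filter mem_enum val_tcast xu.
Qed.

Lemma cellptsP w y : reflect (exists j, y = Fw q w (q j)) (y \in cellpts q w).
Proof.
apply: (iffP mapP) => [[j _ ->]|[j ->]]; first by exists j.
by exists j => //; rewrite mem_enum.
Qed.

(** The neighbors of the junction point are the four other vertices of the two cells; the full sums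
    count the point itself twice, hence the correction. *)
Lemma sum_neighbors w v i j (h : R * R -> R) : size w = size v -> w != v ->
  Fw q w (q i) = Fw q v (q j) ->
  \sum_(y <- neighbors q (size w) (Fw q w (q i))) h y =
  \sum_k h (Fw q w (q k)) + \sum_k h (Fw q v (q k)) - 2 * h (Fw q w (q i)).
Proof.
move=> swv wv e; set x := Fw q w (q i).
pose s := [seq Fw q w (q k) | k <- enum 'I_3 & k != i] ++
          [seq Fw q v (q k) | k <- enum 'I_3 & k != j].
have injV u : injective (fun k => Fw q u (q k)).
  by move=> k l /Fw_inj /q_inj.
have uV u k : uniq [seq Fw q u (q l) | l <- enum 'I_3 & l != k].
  by rewrite (map_inj_uniq (injV u)); apply/filter_uniq/enum_uniq.
have us : uniq s.
  rewrite cat_uniq !uV andbT /=; apply/hasPn => y /mapP[k]; rewrite mem_filter => /andP[kj _] ->.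
  apply/negP => /mapP[l]; rewrite mem_filter => /andP[li _] e'.
  by move: li; rewrite (Fw_common_vertex2 swv wv e (esym e')) eqxx.
have ps : perm_eq (neighbors q (size w) x) s.
  apply: uniq_perm; [exact: undup_uniq|exact: us|move=> y].
  apply/idP/idP.
    move=> /(neighbors_mem _ w)[yx [u [su /cellptsP[k xk] /cellptsP[l yl]]]].
    rewrite mem_cat; apply/orP.
    have [uE|uE] := Fw_common_vertex3 swv su wv e xk; [left|right]; subst u;
      apply/mapP; exists l => //; rewrite mem_filter mem_enum andbT;
      apply: contra yx => /eqP li; by rewrite yl li /x e eqxx.
  rewrite mem_cat => /orP[] /mapP[k]; rewrite mem_filter => /andP[ki _] ->;
    apply/(neighbors_mem _ w); split.
  - by apply: contra ki => /eqP /injV ->.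
  - by exists w; split => //; apply/cellptsP; [exists i|exists k].
  - by apply: contra ki; rewrite /x e => /eqP /injV ->.
  - by exists v; split => //; apply/cellptsP; [exists j|exists k].
rewrite (perm_big _ ps) big_cat /= !big_map !big_filter !big_enum_cond /=.
have -> : \sum_k h (Fw q w (q k)) = h x + \sum_(k | k != i) h (Fw q w (q k)).
  by rewrite (bigD1 i).
have -> : \sum_k h (Fw q v (q k)) = h x + \sum_(k | k != j) h (Fw q v (q k)).
  by rewrite (bigD1 j)//= /x e.
by ring.
Qed.

End geometry.

(** * Mass and integral profiles of a cut cell *)

Section real_limits.
Context {R : realType}.

(** The single ratio 2/3 serves all estimates below: it dominates the ratio 1/2 of cell diameters,
    the decay 3/5 of harmonic oscillations and the contraction of the profile equations. *)
Lemma geometric_small (C e : R) : 0 < e -> exists N, C * (2 / 3) ^+ N < e.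
Proof.
move=> e0; have r1 : `|2 / 3 : R| < 1 by rewrite ger0_norm; lra.
have /cvgrPdist_lt/(_ _ e0)[N _ /(_ N (leqnn N))] := cvg_geometric C r1.
rewrite sub0r normrN /geometric /= => h; exists N.
exact: le_lt_trans (ler_norm _) h.
Qed.

Lemma le_geometric (C x y : R) : (forall N, x <= y + C * (2 / 3) ^+ N) -> x <= y.
Proof.
move=> h; rewrite leNgt; apply/negP => yx.
have [|N hN] := @geometric_small C (x - y); first by rewrite subr_gt0.
by have := h N; lra.
Qed.

Lemma eq_geometric (C x y : R) : (forall N, `|x - y| <= C * (2 / 3) ^+ N) -> x = y.
Proof.
move=> h; apply/eqP; rewrite -subr_eq0 -normr_eq0 eq_le normr_ge0 andbT.
by apply: (@le_geometric C) => N; rewrite add0r.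
Qed.

(* The limit is the common point of the nested intervals
   [f N - 3 C (2/3)^N, f N + 3 C (2/3)^N]. *)
Lemma geometric_limit (C : R) (f : nat -> R) :
  (forall N, `|f N.+1 - f N| <= C * (2 / 3) ^+ N) ->
  exists l, forall N, `|f N - l| <= 3 * C * (2 / 3) ^+ N.
Proof.
move=> h; pose lo N := f N - 3 * C * (2 / 3) ^+ N.
pose hi N := f N + 3 * C * (2 / 3) ^+ N.
have step N : lo N <= lo N.+1 /\ hi N.+1 <= hi N.
  by have := h N; rewrite /lo /hi exprS ler_norml => /andP[h1 h2]; split; lra.
have lohi N : lo N <= hi N.
  suff : 0 <= C * (2 / 3) ^+ N by rewrite /lo /hi; lra.
  exact: le_trans (h N).
have mlo N k : lo N <= lo (N + k)%N.
  by elim: k => [|k IH]; rewrite ?addn0// addnS (le_trans IH)// (step _).1.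
have mhi N k : hi (N + k)%N <= hi N.
  by elim: k => [|k IH]; rewrite ?addn0// addnS (le_trans _ IH)// (step _).2.
have lh N M : lo N <= hi M.
  by rewrite (le_trans (mlo N M))// (le_trans (lohi _))// addnC.
pose A := [set x | exists N, x = lo N].
have supA : has_sup A.
  by split; [exists (lo 0%N), 0%N|exists (hi 0%N) => _ [N ->]].
exists (sup A) => N.
have h1 : lo N <= sup A by apply: ub_le_sup; [exact: supA.2|exists N].
have h2 : sup A <= hi N by apply: ge_sup; [exact: supA.1|move=> _ [M ->]].
by move: h1 h2; rewrite /lo /hi ler_norml => *; apply/andP; split; lra.
Qed.

Lemma uniform_limit_continuous (C : R) (f : nat -> R -> R) (g : R -> R) :
  (forall N, continuous (f N)) ->
  (forall N t, `|f N t - g t| <= C * (2 / 3) ^+ N) -> continuous g.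
Proof.
move=> cf fg t; apply/cvgrPdist_lt => e e0.
have e4 : 0 < e / 4 by rewrite divr_gt0.
have [N hN] := geometric_small C e4.
have /cvgrPdist_lt/(_ _ e4) := cf N t.
apply: filterS => s hs.
have := fg N t; have := fg N s; move: hs.
rewrite !ltr_norml !ler_norml => /andP[? ?] /andP[? ?] /andP[? ?].
by apply/andP; split; lra.
Qed.

Lemma lipschitz_continuous (C : R) (f : R -> R) : 0 < C ->
  (forall x y, `|f x - f y| <= C * `|x - y|) -> continuous f.
Proof.
move=> C0 h x; apply/cvgrPdist_lt => e e0.
have eC : 0 < e / C by rewrite divr_gt0.
have /cvgrPdist_lt/(_ _ eC) := @cvg_id _ (nbhs x).
apply: filterS => y xy.
by rewrite (le_lt_trans (h _ _))// mulrC -ltr_pdivlMr.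
Qed.

End real_limits.

(** * The two profiles and the choice of the cut parameters *)

Section cut_profiles.
Context {R : realType}.

(* In a cell of unit mass whose boundary values are [b], cut the sub-triangle
   [E] of points whose barycentric coordinate at the vertex [a] is at least
   [t]. Then [m t] is the mass of [E], and every harmonic function has integral
   [(m t - 3 * n t) * b a + n t * \sum_j b j] over [E]. The two functional
   equations express the decomposition of [E] along the three subcells. *)
Record cut_profile (m n : R -> R) : Prop := CutProfile {
  cut_m_cont : continuous m;
  cut_n_cont : continuous n;
  cut_m_anti : forall s t, s <= t -> m t <= m s;
  cut_n_anti : forall s t, s <= t -> n t <= n s;
  cut_m_le0 : forall t, t <= 0 -> m t = 1;
  cut_n_le0 : forall t, t <= 0 -> n t = 3^-1;
  cut_m_ge1 : forall t, 1 <= t -> m t = 0;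
  cut_n_ge1 : forall t, 1 <= t -> n t = 0;
  cut_mE : forall t, m t = (m (2 * t - 1) + 2 * m (2 * t)) / 3;
  cut_nE : forall t, n t = (n (2 * t - 1) + n (2 * t) + m (2 * t)) / 5 }.

(** Starting point of the iteration: continuous, nonincreasing, and already equal outside [0, 1] to
    the prescribed values, which every later step preserves. *)
Definition clamp (t : R) : R := Num.min 1 (Num.max 0 (1 - t)).

Fixpoint mapprox (N : nat) (t : R) : R :=
  if N is M.+1 then (mapprox M (2 * t - 1) + 2 * mapprox M (2 * t)) / 3
  else clamp t.

Fixpoint napprox (N : nat) (t : R) : R :=
  if N is M.+1 then
    (napprox M (2 * t - 1) + napprox M (2 * t) + mapprox M (2 * t)) / 5
  else clamp t / 3.

Lemma clamp_bounds t : 0 <= clamp t <= 1.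
Proof. by rewrite /clamp /Num.min /Num.max; do ! case: ifP; lra. Qed.

Lemma clamp_le0 t : t <= 0 -> clamp t = 1.
Proof. by rewrite /clamp /Num.min /Num.max; do ! case: ifP; lra. Qed.

Lemma clamp_ge1 t : 1 <= t -> clamp t = 0.
Proof. by rewrite /clamp /Num.min /Num.max; do ! case: ifP; lra. Qed.

Lemma clamp_anti s t : s <= t -> clamp t <= clamp s.
Proof. by rewrite /clamp /Num.min /Num.max; do ! case: ifP; lra. Qed.

Lemma clamp_lipschitz s t : `|clamp s - clamp t| <= 1 * `|s - t|.
Proof.
wlog st : s t / s <= t.
  move=> hw; case/orP: (le_total s t); first exact: hw.
  by rewrite (distrC (clamp s)) (distrC s); exact: hw.
rewrite mul1r ger0_norm ?subr_ge0 ?clamp_anti// ler0_norm ?subr_le0//.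
by rewrite /clamp /Num.min /Num.max; do ! case: ifP; lra.
Qed.

(** Both [2 * t - 1] and [2 * t] stay nonpositive, and the constants 1 and 1/3 solve the two
    equations. *)
Lemma approx_le0 N t : t <= 0 -> mapprox N t = 1 /\ napprox N t = 3^-1.
Proof.
elim: N t => [|N IH] t t0 /=; first by rewrite clamp_le0//; split => //; lra.
have [-> ->] := IH (2 * t - 1) ltac:(lra).
by have [-> ->] := IH (2 * t) ltac:(lra); split; lra.
Qed.

Lemma approx_ge1 N t : 1 <= t -> mapprox N t = 0 /\ napprox N t = 0.
Proof.
elim: N t => [|N IH] t t0 /=; first by rewrite clamp_ge1//; split => //; lra.
have [-> ->] := IH (2 * t - 1) ltac:(lra).
by have [-> ->] := IH (2 * t) ltac:(lra); split; lra.
Qed.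

Lemma approx_anti N s t : s <= t ->
  mapprox N t <= mapprox N s /\ napprox N t <= napprox N s.
Proof.
elim: N s t => [|N IH] s t st /=; first by have := clamp_anti st; split; lra.
have [] := IH (2 * s - 1) (2 * t - 1) ltac:(lra).
by have [] := IH (2 * s) (2 * t) ltac:(lra); split; lra.
Qed.

Lemma continuous_affine2 (f : R -> R) (c : R) :
  continuous f -> continuous (fun t : R => f (2 * t - c)).
Proof.
move=> cf t; apply: (@continuous_comp R R R (fun u : R => 2 * u - c) f); last exact: cf.
apply: cvgB; last exact: cvg_cst.
by apply: cvgM; [exact: cvg_cst|exact: cvg_id].
Qed.

Lemma approx_continuous N : continuous (mapprox N) /\ continuous (napprox N).
Proof.
elim: N => [|N [cm cn]].
  have cc : continuous clamp by apply: (lipschitz_continuous _ clamp_lipschitz).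
  by split => // t; apply: cvgM; [exact: cc|exact: cvg_cst].
have c2 (f : R -> R) : continuous f -> continuous (fun t : R => f (2 * t)).
  move=> cf t; apply: (@continuous_comp R R R (fun u : R => 2 * u) f); last exact: cf.
  by apply: cvgM; [exact: cvg_cst|exact: cvg_id].
split => t /=; apply: cvgM; try exact: cvg_cst.
  apply: cvgD; first exact: (continuous_affine2 cm).
  by apply: cvgM; [exact: cvg_cst|exact: c2].
by apply: cvgD; [apply: cvgD|]; [exact: (continuous_affine2 cn)|exact: c2|exact: c2].
Qed.

(** One of the arguments [2 * t - 1] and [2 * t] always falls where all approximants agree, so a
    single branch contributes, with total weight at most 2/3. *)
Lemma approx_cauchy N t :
  `|mapprox N.+1 t - mapprox N t| <= 1 * (2 / 3) ^+ N /\
  `|napprox N.+1 t - napprox N t| <= 1 * (2 / 3) ^+ N.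
Proof.
elim: N t => [|N IH] t.
  rewrite /= expr0 !ler_norml.
  have := clamp_bounds t; have := clamp_bounds (2 * t).
  have := clamp_bounds (2 * t - 1) => /andP[? ?] /andP[? ?] /andP[? ?].
  by split; apply/andP; split; lra.
have p0 : 0 <= (2 / 3 : R) ^+ N by rewrite exprn_ge0//; lra.
have mSE u : mapprox N.+2 u =
  (mapprox N.+1 (2 * u - 1) + 2 * mapprox N.+1 (2 * u)) / 3 by [].
have nSE u : napprox N.+2 u = (napprox N.+1 (2 * u - 1) +
  napprox N.+1 (2 * u) + mapprox N.+1 (2 * u)) / 5 by [].
have mE u : mapprox N.+1 u =
  (mapprox N (2 * u - 1) + 2 * mapprox N (2 * u)) / 3 by [].
have nE u : napprox N.+1 u = (napprox N (2 * u - 1) +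
  napprox N (2 * u) + mapprox N (2 * u)) / 5 by [].
rewrite mSE nSE [mapprox N.+1 t]mE [napprox N.+1 t]nE exprS !ler_norml.
have := IH (2 * t); have := IH (2 * t - 1); rewrite !ler_norml.
have [h|h] := lerP t (2^-1).
  have [-> ->] := approx_le0 N (ltac:(lra) : 2 * t - 1 <= 0).
  have [-> ->] := approx_le0 N.+1 (ltac:(lra) : 2 * t - 1 <= 0).
  move=> _ [/andP[h1 h2] /andP[h3 h4]].
  by split; apply/andP; split; lra.
have [-> ->] := approx_ge1 N (ltac:(lra) : 1 <= 2 * t).
have [-> ->] := approx_ge1 N.+1 (ltac:(lra) : 1 <= 2 * t).
move=> [/andP[h1 h2] /andP[h3 h4]] _.
by split; apply/andP; split; lra.
Qed.

Lemma cut_profile_exists : exists m n : R -> R, cut_profile m n.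
Proof.
have [m hm] := choice (fun t => geometric_limit (fun N => (approx_cauchy N t).1)).
have [n hn] := choice (fun t => geometric_limit (fun N => (approx_cauchy N t).2)).
have p0 N : 0 <= (2 / 3 : R) ^+ N by rewrite exprn_ge0//; lra.
have {}hm t N : - (3 * (2 / 3) ^+ N) <= mapprox N t - m t <= 3 * (2 / 3) ^+ N.
  by have := hm t N; rewrite mulr1 ler_norml.
have {}hn t N : - (3 * (2 / 3) ^+ N) <= napprox N t - n t <= 3 * (2 / 3) ^+ N.
  by have := hn t N; rewrite mulr1 ler_norml.
exists m, n; split.
- apply: (@uniform_limit_continuous _ 3 mapprox) => [N|N t].
    exact: (approx_continuous N).1.
  by rewrite ler_norml.
- apply: (@uniform_limit_continuous _ 3 napprox) => [N|N t].
    exact: (approx_continuous N).2.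
  by rewrite ler_norml.
- move=> s t st; apply: (@le_geometric _ 6) => N.
  have [] := approx_anti N st; have /andP[? ?] := hm s N.
  by have /andP[? ?] := hm t N; lra.
- move=> s t st; apply: (@le_geometric _ 6) => N.
  have [] := approx_anti N st; have /andP[? ?] := hn s N.
  by have /andP[? ?] := hn t N; lra.
- move=> t t0; apply: (@eq_geometric _ 3) => N.
  have [h _] := approx_le0 N t0; have /andP[? ?] := hm t N.
  by rewrite ler_norml; apply/andP; split; lra.
- move=> t t0; apply: (@eq_geometric _ 3) => N.
  have [_ h] := approx_le0 N t0; have /andP[? ?] := hn t N.
  by rewrite ler_norml; apply/andP; split; lra.
- move=> t t0; apply: (@eq_geometric _ 3) => N.
  have [h _] := approx_ge1 N t0; have /andP[? ?] := hm t N.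
  by rewrite ler_norml; apply/andP; split; lra.
- move=> t t0; apply: (@eq_geometric _ 3) => N.
  have [_ h] := approx_ge1 N t0; have /andP[? ?] := hn t N.
  by rewrite ler_norml; apply/andP; split; lra.
(* The recursion is exact between levels [N.+1] and [N]; the approximation errors at the three
   points add up to at most 6 times the power. *)
- move=> t; apply: (@eq_geometric _ 6) => N.
  have /= /andP[? ?] := hm t N.+1; have /andP[? ?] := hm (2 * t) N.
  have /andP[? ?] := hm (2 * t - 1) N; have := p0 N.
  rewrite ler_norml => *; apply/andP.
  by split; move: (exprS (2 / 3 : R) N) => *; lra.
- move=> t; apply: (@eq_geometric _ 6) => N.
  have /= /andP[? ?] := hn t N.+1; have /andP[? ?] := hn (2 * t) N.
  have /andP[? ?] := hn (2 * t - 1) N; have /andP[? ?] := hm (2 * t) N.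
  have := p0 N; rewrite ler_norml => *; apply/andP.
  by split; move: (exprS (2 / 3 : R) N) => *; lra.
Qed.

Lemma cut_solve (m n : R -> R) (a : 'I_3 -> R) : cut_profile m n ->
  (forall i, 0 <= a i) -> \sum_i a i = 1 ->
  exists (t : 'I_3 -> R) (S : R), [/\ forall i, 0 <= t i <= 1,
    S = 1 + \sum_i m (t i) & forall i, m (t i) + 3 * n (t i) = a i * S].
Proof.
move=> P a0 a1; pose g t := m t + 3 * n t.
(* As [g] runs from 2 at 0 to 0 at 1, truncating to [0, 2] makes [g t = cl u] solvable for every
   [u]; at the solution the truncation turns out to be inactive. *)
pose cl (u : R) := Num.min 2 (Num.max 0 u).
have clE u : 0 <= cl u <= 2.
  by rewrite /cl /Num.min /Num.max; do ! case: ifP; lra.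
have ex u : exists t : R, 0 <= t <= 1 /\ g t = cl u.
  have cg : {within `[0, 1], continuous g}.
    apply: continuous_subspaceT => t; apply: cvgD; first exact: cut_m_cont P t.
    by apply: cvgM; [exact: cvg_cst|exact: cut_n_cont P t].
  have := @IVT R g 0 1 (cl u) ler01 cg.
  have -> : g 0 = 2.
    by rewrite /g (cut_m_le0 P (lexx _)) (cut_n_le0 P (lexx _)); lra.
  have -> : g 1 = 0.
    by rewrite /g (cut_m_ge1 P (lexx _)) (cut_n_ge1 P (lexx _)); lra.
  rewrite /Num.min /Num.max; case: ifP => [|_]; first lra.
  move=> /(_ (clE u))[t].
  by rewrite in_itv /= => t01 gt; exists t.
have [T hT] := choice ex.
pose M u := m (T u).
(* The chosen [T] need not be continuous, but [m] and [n] vary in the same direction, so the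
   variation of [m] is at most that of [g]. *)
have ML u v : `|M u - M v| <= `|u - v|.
  wlog uv : u v / T u <= T v.
    move=> hw; case/orP: (le_total (T u) (T v)); first exact: hw.
    by rewrite (distrC (M u)) (distrC u); exact: hw.
  have := cut_m_anti P uv; have := cut_n_anti P uv.
  have [_] := hT u; have [_] := hT v; rewrite /g -/(M u) -/(M v) => h1 h2 h3 h4.
  rewrite ger0_norm ?subr_ge0//.
  have := ler_norm (u - v); have := ler_norm (- (u - v)); rewrite normrN.
  move: h1 h2; rewrite /cl /Num.min /Num.max.
  by do ! case: ifP; lra.
have M0 u : 0 <= M u.
  have [/andP[_ h] _] := hT u.
  by have := cut_m_anti P h; rewrite (cut_m_ge1 P (lexx _)).
have N0 u : 0 <= n (T u).
  have [/andP[_ h] _] := hT u.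
  by have := cut_n_anti P h; rewrite (cut_n_ge1 P (lexx _)).
have M1 u : M u <= 1.
  have [/andP[h _] _] := hT u.
  by have := cut_m_anti P h; rewrite (cut_m_le0 P (lexx _)).
(* As [n] is nonnegative here, [M u] is at most [g (T u)], the truncation of [u]. *)
have Mid u : 0 <= u -> M u <= u.
  move=> u0; have [_] := hT u; have := N0 u; rewrite /g -/(M u) /cl.
  by rewrite /Num.min /Num.max; do ! case: ifP; lra.
(* A zero of [phi] is the sought [S]. It lies between 1 and 4 because the three values of [M] lie in
   [0, 1]. *)
pose phi S := S - 1 - \sum_i M (a i * S).
have ai1 i : a i <= 1.
  by move: a1 (a0 i0) (a0 i1) (a0 i2); rewrite sum3; elim/I3_ind: i; lra.
have cphi : continuous phi.
  apply: (@lipschitz_continuous _ 4) => // x y; rewrite /phi !sum3.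
  have h i : `|M (a i * x) - M (a i * y)| <= `|x - y|.
    rewrite (le_trans (ML _ _))// -mulrBr normrM (ger0_norm (a0 i)).
    by rewrite ler_piMl// normr_ge0.
  have := h i0; have := h i1; have := h i2; have := ler_norm (x - y).
  have := ler_norm (- (x - y)); rewrite normrN !ler_norml.
  move=> ? ? /andP[? ?] /andP[? ?] /andP[? ?].
  by apply/andP; split; lra.
have phi1 : phi 1 <= 0.
  by rewrite /phi sum3; have := M0 (a i0 * 1); have := M0 (a i1 * 1);
    have := M0 (a i2 * 1); lra.
have phi4 : 0 <= phi 4.
  by rewrite /phi sum3; have := M1 (a i0 * 4); have := M1 (a i1 * 4);
    have := M1 (a i2 * 4); lra.
have le14 : (1 : R) <= 4 by lra.
have [|S] := @IVT R phi 1 4 0 le14 (continuous_subspaceT cphi).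
  rewrite /Num.min /Num.max.
  by case: ifP => [h|/negbT]; [|rewrite -leNgt => h]; apply/andP; split; lra.
rewrite in_itv /= => /andP[S1 S4]; rewrite /phi sum3 => hS.
have aS0 i : 0 <= a i * S by rewrite mulr_ge0//; lra.
(* Bounding [M] by 1 at index [i] and by its argument at the other two gives
   [S <= 2 + (S - a i * S)]. *)
have aS2 i : a i * S <= 2.
  have sS : a i0 * S + a i1 * S + a i2 * S = S.
    by rewrite -!mulrDl -sum3 a1 mul1r.
  move: sS (M1 (a i * S)) (Mid _ (aS0 i0)) (Mid _ (aS0 i1)) (Mid _ (aS0 i2)).
  by clear -hS; elim/I3_ind: i; lra.
exists (fun i => T (a i * S)), S; split.
- by move=> i; exact: (hT _).1.
- by rewrite sum3 -/(M _) -/(M _) -/(M _); lra.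
- move=> i; have [_] := hT (a i * S); rewrite /g => ->.
  move: (aS0 i) (aS2 i); rewrite /cl /Num.min /Num.max.
  by do ! case: ifP; lra.
Qed.

End cut_profiles.

(** * The gasket *)

Section gasket.
Context {R : realType}.
Implicit Types (z p : R * R) (w v u : seq 'I_3) (i j a c : 'I_3) (t : R).
Variables (q : 'I_3 -> R * R) (K : set (R * R)).
Hypotheses (qeq : equilateral q) (hK : is_SG q K).

Lemma SG_compact : compact K. Proof. by case: hK. Qed.

Lemma SG_closed : closed K.
Proof. exact: compact_closed (@norm_hausdorff _ _) SG_compact. Qed.

Lemma SG_Fmap a z : K z -> K (Fmap q a z).
Proof. by move=> Kz; case: hK => _ [_ ->]; exists a => //; exists z. Qed.

Lemma SG_Fw w z : K z -> K (Fw q w z).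
Proof. by move=> Kz; elim: w => //= a w; exact: SG_Fmap. Qed.

Lemma cell_sub w : cell q K w `<=` K.
Proof. by move=> _ [z Kz <-]; exact: SG_Fw. Qed.

Lemma cell_cat w v : cell q K (w ++ v) `<=` cell q K w.
Proof.
by move=> _ [z Kz <-]; exists (Fw q v z); [exact: SG_Fw|rewrite Fw_cat].
Qed.

(** As [K] is the union of its three images, a letter and a preimage can be chosen at each of its
    points; iterating the choice from [z] gives nested cells around [z]. *)
Lemma SG_address z : K z -> exists (u : nat -> seq 'I_3) (zs : nat -> R * R),
  [/\ u 0%N = [::], forall N, size (u N) = N,
      forall N, exists a, u N.+1 = rcons (u N) a &
      forall N, K (zs N) /\ z = Fw q (u N) (zs N)].
Proof.
move=> Kz.
have ex p : exists s : 'I_3 * (R * R), K p -> K s.2 /\ p = Fmap q s.1 s.2.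
  (* Points outside [K] get a dummy value, which makes the choice total. *)
  have [Kp|nKp] := pselect (K p); last by exists (i0, p).
  case: hK => _ [_ KE]; move: (Kp); rewrite {1}KE => -[a _ [p' Kp' <-]].
  by exists (a, p').
have [s hs] := choice ex.
pose zs N := iter N (fun p => (s p).2) z.
pose u := fix u N := if N is M.+1 then rcons (u M) (s (zs M)).1 else [::].
have Kzs N : K (zs N) by elim: N => //= N IH; exact: (hs _ IH).1.
exists u, zs; split => //.
- by elim=> //= N; rewrite size_rcons => ->.
- by move=> N; eexists.
- elim=> [//|N [_ IH]]; split; first exact: Kzs.
  by rewrite /= -cats1 Fw_cat /= -(hs _ (Kzs N)).2.
Qed.

Lemma cell_level z N : K z -> exists2 w, size w = N & cell q K w z.
Proof.
move=> Kz; have [u [zs [_ su _ uz]]] := SG_address Kz.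
by exists (u N) => //; exists (zs N); [exact: (uz N).1|rewrite -(uz N).2].
Qed.

Lemma Fw_sub w z p : Fw q w z - Fw q w p = 2^-1 ^+ size w *: (z - p).
Proof.
rewrite (FwE q w z) (FwE q w p); case: z p => z1 z2 [p1 p2].
by congr (_, _); rewrite /= /GRing.scale /=; ring.
Qed.

Lemma SG_diam : exists2 D : R, 0 < D & forall z p, K z -> K p -> `|z - p| <= D.
Proof.
have [M [_ hM]] := compact_bounded SG_compact.
exists (2 * (`|M| + 1)); first by rewrite mulr_gt0// ltr_wpDl.
have Mlt : M < `|M| + 1 by rewrite (le_lt_trans (ler_norm _))// ltrDl.
move=> z p Kz Kp; apply: le_trans (ler_normB _ _) _.
by rewrite mulr_natl mulr2n lerD// hM.
Qed.

Lemma half_pow_le N : (2^-1 : R) ^+ N <= (2 / 3) ^+ N.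
Proof. by rewrite lerXn2r ?nnegrE//; lra. Qed.

Lemma cell_diam : exists2 D : R, 0 < D & forall w z p,
  cell q K w z -> cell q K w p -> `|z - p| <= D * (2 / 3) ^+ size w.
Proof.
have [D D0 hD] := SG_diam; exists D => // w _ _ [z Kz <-] [p Kp <-].
rewrite Fw_sub normrZ ger0_norm ?exprn_ge0// mulrC.
by rewrite ler_pM ?normr_ge0 ?exprn_ge0 ?hD ?half_pow_le.
Qed.

(** Iterating [Fmap q i] from any point of [K] converges to [q i], and [K] is closed. *)
Lemma SG_vertex i : K (q i).
Proof.
apply: SG_closed => B /nbhs_ballP[e /= e0 eB].
case: (hK) => _ [[z Kz] _].
have [N hN] := geometric_small `|q i - z| e0.
exists (Fw q (nseq N i) z); split; first exact: SG_Fw.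
apply: eB; rewrite -ball_normE /=.
rewrite -{1}(Fw_nseq q N i) Fw_sub size_nseq normrZ ger0_norm ?exprn_ge0//.
by rewrite mulrC (le_lt_trans _ hN)// ler_wpM2l// half_pow_le.
Qed.

Lemma cell_vertex w i : cell q K w (Fw q w (q i)).
Proof. by exists (q i) => //; exact: SG_vertex. Qed.

Lemma bary_continuous i : continuous (bary q i).
Proof.
move=> z; rewrite /bary /dot /=; apply: cvgB; first exact: cvg_cst.
apply: cvgM; last exact: cvg_cst.
apply: cvgM; first exact: cvg_cst.
apply: cvgD; (apply: cvgM; last exact: cvg_cst);
  (apply: cvgB; last exact: cvg_cst); [exact: cvg_fst|exact: cvg_snd].
Qed.

(** Coordinates are bounded on the compact [K], and each map halves a negative coordinate or raises
    it further; the possible negative part thus decays to 0. *)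
Lemma SG_triangle : K `<=` triangle q.
Proof.
move=> z Kz i; rewrite -oppr_le0.
have [M hM] : exists M : R, forall p, K p -> `|bary q i p| <= M.
  have cb : {within K, continuous (bary q i)}.
    by apply: continuous_subspaceT; exact: bary_continuous.
  have [M [_ hM]] := compact_bounded (continuous_compact cb SG_compact).
  exists (`|M| + 1) => p Kp; apply: hM; last by exists p.
  by rewrite (le_lt_trans (ler_norm _))// ltrDl.
have M0 : 0 <= M by apply: le_trans (hM _ Kz).
apply: (@le_geometric _ M) => N; rewrite add0r.
elim: N z Kz => [|N IH] z Kz.
  by rewrite expr0 mulr1 (le_trans (ler_norm _))// normrN hM.
case: (hK) => _ [_ KE]; move: Kz; rewrite {1}KE => -[a _ [p Kp <-]].
rewrite (bary_Fmap qeq) exprS.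
have : 0 <= M * (2 / 3) ^+ N by rewrite mulr_ge0// exprn_ge0//; lra.
by move: (IH p Kp); case: (i == a) => /=; lra.
Qed.

Lemma bary_le1 i z : triangle q z -> bary q i z <= 1.
Proof.
move=> tz; have := bary_sum qeq z; rewrite sum3.
by move: (tz i0) (tz i1) (tz i2); elim/I3_ind: i; lra.
Qed.

Lemma Fw_continuous w : continuous (Fw q w).
Proof.
have -> : Fw q w = (fun z => 2^-1 ^+ size w *: z + Fw q w (0, 0)).
  by apply: funext => z; rewrite [LHS]FwE; case: z.
by move=> z; apply: cvgD; [exact: scaler_continuous|exact: cvg_cst].
Qed.

(** The threshold is imposed in the unit triangle, before [Fw q v] is applied, so that subdivision
    changes only the word and the threshold. *)
Definition cut a v t : set (R * R) := Fw q v @` [set z | K z /\ t <= bary q a z].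

Lemma cut_sub_cell a v t : cut a v t `<=` cell q K v.
Proof. by move=> _ [z [Kz _] <-]; exists z. Qed.

Lemma cut_le0 a v t : t <= 0 -> cut a v t = cell q K v.
Proof.
move=> t0; apply/seteqP; split => [|_ [z Kz <-]]; first exact: cut_sub_cell.
by exists z => //; split => //; rewrite (le_trans t0)//; exact: SG_triangle.
Qed.

Lemma cut_gt1 a v t : 1 < t -> cut a v t = set0.
Proof.
move=> t1; apply/seteqP; split => // p [z [Kz tz] _]; exfalso.
by have := bary_le1 a (SG_triangle Kz); rewrite leNgt (lt_le_trans t1 tz).
Qed.

(** Source of the arguments [2 * t - 1] and [2 * t] of the profile equations: pulling back through
    [Fmap q c] doubles the threshold and subtracts 1 when [c = a]. *)
Lemma cut_split a v t : cut a v t =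
  cut a (rcons v i0) (2 * t - (a == i0)%:R) `|`
  (cut a (rcons v i1) (2 * t - (a == i1)%:R) `|`
   cut a (rcons v i2) (2 * t - (a == i2)%:R)).
Proof.
have sub c : cut a (rcons v c) (2 * t - (a == c)%:R) `<=` cut a v t.
  move=> _ [z [Kz tz] <-]; exists (Fmap q c z); last by rewrite -cats1 Fw_cat.
  by split; [exact: SG_Fmap|rewrite (bary_Fmap qeq); lra].
apply/seteqP; split; last first.
  by move=> z [|[]]; exact: sub.
move=> _ [z [Kz tz] <-]; case: (hK) => _ [_ KE].
move: (Kz); rewrite {1}KE => -[c _ [p Kp pz]].
have : cut a (rcons v c) (2 * t - (a == c)%:R) (Fw q v z).
  exists p; last by rewrite -cats1 Fw_cat /= pz.
  by split => //; move: tz; rewrite -pz (bary_Fmap qeq); lra.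
by elim/I3_ind: c {pz}; [left|right; left|right; right].
Qed.

Lemma cell_split v : cell q K v =
  cell q K (rcons v i0) `|` (cell q K (rcons v i1) `|` cell q K (rcons v i2)).
Proof.
(* Any nonpositive threshold turns a cut into the whole cell. *)
have neg : -2 <= 0 :> R by lra.
rewrite -!(fun u => @cut_le0 i0 u (-2) neg) cut_split.
by congr (_ `|` (_ `|` _)); rewrite !cut_le0//=; lra.
Qed.

Lemma cut_compact a v t : compact (cut a v t).
Proof.
apply: continuous_compact.
  by apply: continuous_subspaceT; exact: Fw_continuous.
apply: (@compact_closedI _ K [set z | t <= bary q a z]); first exact: SG_compact.
apply: (@closed_comp _ _ (bary q a) [set x | t <= x]); last exact: closed_ge.
by move=> z _; exact: bary_continuous.
Qed.

(** Both sides of the defining inequality scale with the cell, which reduces it to the unit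
    triangle; there the height is 3/2 of the distance from vertex to centroid, as [bary] is
    normalized. *)
Lemma Ecut_cut w v i a (c : R) : size v = size w -> Fw q v (q a) = Fw q w (q i) ->
  Ecut q K w v i c = cut a v (1 - c).
Proof.
move=> svw e; pose s : R := 2^-1 ^+ size w; have s0 : 0 < s by rewrite exprn_gt0.
have L0 := sqside_gt0 qeq.
have dist z : dot (vsub (Fw q v z) (Fw q w (q i))) (axis q w v i) <=
    c * height q w <-> 1 - c <= bary q a z.
  pose d := vsub (centroid q [::]) (q a).
  have dd : dot d d = sqside q / 3 by rewrite dot_axis_self.
  have d0 : 0 < vnorm d by rewrite sqrtr_gt0 dd; lra.
  have dE : vsub (centroid q v) (Fw q w (q i)) = vscale s d.
    rewrite -e /centroid !(FwE q v (q _)) svw -/s /d /centroid /vsub /vscale /vadd /=.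
    by congr (_, _); field.
  have nE y : vnorm (vscale s y) = s * vnorm y.
    have -> : vnorm (vscale s y) = Num.sqrt (s ^+ 2 * dot y y).
      by rewrite /vnorm /dot /vscale /=; congr Num.sqrt; ring.
    by rewrite sqrtrM ?sqr_ge0// sqrtr_sqr gtr0_norm.
  have zE : vsub (Fw q v z) (Fw q w (q i)) = vscale s (vsub z (q a)).
    rewrite -e (FwE q v z) (FwE q v (q a)) svw -/s /vsub /vscale /=.
    by congr (_, _); ring.
  have hE : height q w = s * (3 / 2) * vnorm d.
    have -> : height q w = Num.sqrt 3 / 2 * (s * Num.sqrt (sqside q)).
      rewrite /height -[in RHS]/(vnorm (vsub (q i0) (q i1))) -nE.
      congr (_ * vnorm _); rewrite (FwE q w (q i0)) (FwE q w (q i1)) -/s.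
      by rewrite /vsub /vscale /=; congr (_, _); ring.
    (* The side is the circumradius times the square root of 3. *)
    have -> : Num.sqrt (sqside q) = Num.sqrt 3 * vnorm d.
      by rewrite /vnorm dd -sqrtrM//; congr Num.sqrt; field.
    have s3 : Num.sqrt (3 : R) * Num.sqrt 3 = 3 by rewrite -expr2 sqr_sqrtr.
    have -> : Num.sqrt 3 / 2 * (s * (Num.sqrt 3 * vnorm d)) =
      (Num.sqrt 3 * Num.sqrt 3) * (s / 2 * vnorm d) by field.
    by rewrite s3; field.
  rewrite /axis dE zE nE hE.
  have -> : dot (vscale s (vsub z (q a))) (vscale (s * vnorm d)^-1 (vscale s d)) =
      s * dot (vsub z (q a)) d / vnorm d.
    by rewrite /dot /vscale /=; field; rewrite !gt_eqF.
  rewrite ler_pdivrMr//.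
  have -> : c * (s * (3 / 2) * vnorm d) * vnorm d = s * (c * (3 / 2) * dot d d).
    by rewrite -[dot d d]sqr_sqrtr ?dot_ge0// -/(vnorm d); ring.
  rewrite ler_pM2l// dd /bary -/d.
  have -> : c * (3 / 2) * (sqside q / 3) = c * (sqside q / 2) by field.
  set X := dot _ d; pose y := 2 * X / sqside q.
  have -> : X = y * (sqside q / 2) by rewrite /y; field; rewrite gt_eqF.
  have -> : 2 * (y * (sqside q / 2)) / sqside q = y by field; rewrite gt_eqF.
  by rewrite ler_pM2r ?divr_gt0//; split; lra.
apply/seteqP; split => z.
  by move=> [[p Kp <-]] /dist h; exists p.
by move=> [p [Kp /dist h] <-]; split => //; exists p.
Qed.

End gasket.

(** * Harmonic functions *)

Section harmonic_extension.
Context {R : realType}.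
Implicit Types (b : 'I_3 -> R) (u : seq 'I_3) (c i j : 'I_3).

(* The 1/5-2/5 rule: the boundary values on the subcell [c] of a harmonic
   function with boundary values [b]. *)
Definition hext b c j : R :=
  if c == j then b c else (b c + b j + \sum_k b k) / 5.

(** A left fold, since the first letter names the largest subcell. *)
Definition hextw u b : 'I_3 -> R := foldl hext b u.

(** One-step maximum principle: a new value is an old one or a mean of the old ones with weights
    2/5, 2/5, 1/5. *)
Lemma hext_range b c j (y e : R) : (forall i, `|b i - y| <= e) ->
  `|hext b c j - y| <= e.
Proof.
move=> h; have := h i0; have := h i1; have := h i2; rewrite /hext sum3 !ler_norml.
move=> /andP[? ?] /andP[? ?] /andP[? ?]; apply/andP.
by elim/I3_ind: c; elim/I3_ind: j; split => /=; lra.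
Qed.

Lemma hext_osc b c (e : R) : (forall i j, `|b i - b j| <= e) ->
  forall i j, `|hext b c i - hext b c j| <= e * (2 / 3).
Proof.
move=> h i j; move: (h i0 i1) (h i0 i2) (h i1 i2); rewrite /hext sum3 !ler_norml.
move=> /andP[? ?] /andP[? ?] /andP[? ?]; apply/andP.
by elim/I3_ind: c; elim/I3_ind: i; elim/I3_ind: j; split => /=; lra.
Qed.

Lemma hextw_osc b u (e : R) : (forall i j, `|b i - b j| <= e) ->
  forall i j, `|hextw u b i - hextw u b j| <= e * (2 / 3) ^+ size u.
Proof.
move=> h; elim/last_ind: u => [|u c IH] i j; first by rewrite mulr1.
by rewrite /hextw foldl_rcons size_rcons exprSr (mulrA e); exact: hext_osc.
Qed.

Lemma hextw_ge0 b u : (forall i, 0 <= b i) -> forall i, 0 <= hextw u b i.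
Proof.
move=> h; elim/last_ind: u => [|u c IH] i //.
rewrite /hextw foldl_rcons /hext -/(hextw u b) sum3.
by case: ifP => // _; have := IH c; have := IH i; have := IH i0;
  have := IH i1; have := IH i2; lra.
Qed.

Lemma hextw_cst u (x : R) : hextw u (fun=> x) = (fun=> x).
Proof.
elim/last_ind: u => [//|u c IH]; rewrite /hextw foldl_rcons -/(hextw _ _) IH.
by apply: funext => j; rewrite /hext sum3; case: ifP => // _; lra.
Qed.

Lemma hextw_linear u b i :
  hextw u b i = \sum_j b j * hextw u (fun k => (k == j)%:R) i.
Proof.
elim/last_ind: u i => [|u c IH] i.
  by rewrite sum3; elim/I3_ind: i => /=; lra.
rewrite /hextw foldl_rcons -/(hextw _ _) sum3 !foldl_rcons -!/(hextw _ _).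
rewrite /hext sum3 !IH !sum3; case: ifP => _; lra.
Qed.

End harmonic_extension.

(** * Harmonic functions through their boundary values on cells *)

Section regular.
Context {R : realType}.
Implicit Types (z p : R * R) (w v u : seq 'I_3) (i j a c : 'I_3) (t : R).
Variables (q : 'I_3 -> R * R) (K : set (R * R)).
Hypotheses (qeq : equilateral q) (hK : is_SG q K).
Implicit Types h : R * R -> R.

Definition bval h w j : R := h (Fw q w (q j)).

(** Harmonicity read cell by cell: equations linking adjacent cells are replaced by a rule passing
    values from a cell to its subcells. *)
Definition regular h := {within K, continuous h} /\
  forall w c j, bval h (rcons w c) j = hext (bval h w) c j.

Lemma bval_rcons h w c : bval h (rcons w c) c = bval h w c.
Proof.
rewrite /bval -cats1 Fw_cat; congr (h (Fw q w _)); exact: (Fw_nseq q 1 c).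
Qed.

Lemma bval_rconsC h w a c : bval h (rcons w a) c = bval h (rcons w c) a.
Proof. by rewrite /bval -!cats1 !Fw_cat; congr (h (Fw q w _)); exact: midptC. Qed.

Lemma cst_regular (x : R) : regular (fun=> x).
Proof.
split; first by move=> z; exact: cvg_cst.
by move=> w c j; rewrite /bval /hext sum3; case: ifP => // _; lra.
Qed.

(** The equations at the three edge midpoints of a cell form a linear system whose solution is the
    1/5-2/5 rule. *)
Lemma harmonic_regular h : Defs.harmonic q K h -> regular h.
Proof.
move=> [ch hh]; split => // w.
have mid a c : a != c -> 6 * bval h (rcons w a) c =
    \sum_k bval h (rcons w a) k + \sum_k bval h (rcons w c) k.
  move=> ac; pose x := Fw q (rcons w a) (q c).
  have e : x = Fw q (rcons w c) (q a).
    by rewrite /x -!cats1 !Fw_cat; congr (Fw q w _); exact: midptC.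
  have sw : size (rcons w a) = size (rcons w c) by rewrite !size_rcons.
  have wn : rcons w a != rcons w c.
    by apply: contra ac => /eqP/rcons_inj[->].
  have m1 : (1 <= size (rcons w a))%N by rewrite size_rcons.
  have := hh _ m1 (Fw q (rcons w a) (q c)).
  rewrite (sum_neighbors qeq h sw wn e) -/(bval h (rcons w a) c) => hx.
  suff : bval h (rcons w a) c = 4^-1 *
    (\sum_k bval h (rcons w a) k + \sum_k bval h (rcons w c) k -
     2 * bval h (rcons w a) c) by lra.
  apply: hx; first by exists (in_tuple (rcons w a)), c.
  (* Were the midpoint a corner [q k], both words would consist of [k] only, against [a != c]. *)
  move=> [k _ kx].
  have last_nseq s b n : rcons s b = nseq n k -> b = k.
    move=> sn; have : b \in rcons s b by rewrite mem_rcons mem_head.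
    by rewrite sn mem_nseq => /andP[_ /eqP].
  have ak := last_nseq _ _ _ (Fw_vertex qeq (esym kx)).
  have ck := last_nseq _ _ _ (Fw_vertex qeq (etrans (esym e) (esym kx))).
  by move: ac; rewrite ak ck eqxx.
move: (mid i0 i1 isT) (mid i0 i2 isT) (mid i1 i2 isT); rewrite !sum3.
rewrite (bval_rconsC h w i1 i0) (bval_rconsC h w i2 i0) (bval_rconsC h w i2 i1).
rewrite !bval_rcons => h1 h2 h3 a c; rewrite /hext sum3.
elim/I3_ind: a; elim/I3_ind: c; rewrite /= ?bval_rcons //;
  rewrite ?(bval_rconsC h w i1 i0) ?(bval_rconsC h w i2 i0) ?(bval_rconsC h w i2 i1);
  lra.
Qed.

Lemma bval_cat h w u : regular h -> bval h (w ++ u) = hextw u (bval h w).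
Proof.
move=> [_ rh]; elim/last_ind: u => [|u c IH]; first by rewrite cats0.
rewrite -rcons_cat /hextw foldl_rcons -/(hextw _ _) -IH.
by apply: funext => j; exact: rh.
Qed.

Lemma regular_eps h x (e : R) : regular h -> K x -> 0 < e ->
  exists2 d : R, 0 < d & forall y, K y -> `|x - y| < d -> `|h x - h y| < e.
Proof.
move=> [/subspace_continuousP ch _] Kx e0.
have /cvgrPdist_lt/(_ _ e0) := ch x Kx.
move=> /nbhs_ballP[d /= d0 dh]; exists d => // y Ky xy.
by apply: dh => //; rewrite -ball_normE.
Qed.

(** The one-step maximum principle carries the bound to the vertices of all smaller cells, and
    continuity carries it on to [z]. *)
Lemma cell_range h w z (y e : R) : regular h -> cell q K w z ->
  (forall j, `|bval h w j - y| <= e) -> `|h z - y| <= e.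
Proof.
move=> rh wz hb; apply/ler_addgt0Pr => e' e'0.
have Kz : K z by exact: cell_sub wz.
have [d d0 hd] := regular_eps rh Kz e'0.
case: wz => z' Kz' zE; have [u [zs [_ su _ uz]]] := SG_address hK Kz'.
have [D D0 hD] := cell_diam hK; have [N hN] := geometric_small D d0.
pose x := Fw q (w ++ u N) (q i0).
have cx : cell q K (w ++ u N) x by exact: cell_vertex.
have cz : cell q K (w ++ u N) z.
  exists (zs N); first exact: (uz N).1.
  by rewrite Fw_cat -(uz N).2.
have xy : `|h x - y| <= e.
  rewrite -/(bval h (w ++ u N) i0) bval_cat //.
  elim/last_ind: (u N) i0 => [|s c IH] i; first exact: hb.
  by rewrite /hextw foldl_rcons; exact: hext_range.
have zx : `|h z - h x| < e'.
  apply: hd; first exact: cell_sub cx.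
  rewrite (le_lt_trans (hD _ _ _ cz cx))// size_cat su.
  rewrite (le_lt_trans _ hN)// ler_wpM2l// ?(ltW D0)// exprD.
  rewrite ler_piMl ?exprn_ge0// ?exprn_ile1//; lra.
rewrite (le_trans (ler_distD (h x) _ _))// addrC lerD// ltW//.
Qed.

(** Weight [j] is the limit, along an address of the point, of the extension of the indicator of
    vertex [j]. The address ignores [h], hence so do the weights. *)
Lemma cell_weights w x : cell q K w x -> exists a : 'I_3 -> R,
  [/\ forall j, 0 <= a j, \sum_j a j = 1 &
      forall h, regular h -> h x = \sum_j a j * bval h w j].
Proof.
move=> [x' Kx' xE]; have [u [zs [_ su uS uz]]] := SG_address hK Kx'.
pose f j N := hextw (u N) (fun k => (k == j)%:R : R) i0.
have osc j N i k : `|hextw (u N) (fun k => (k == j)%:R : R) i -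
    hextw (u N) (fun k => (k == j)%:R) k| <= (2 / 3) ^+ N.
  rewrite -[leRHS]mul1r -[in leRHS](su N); apply: hextw_osc => i' j'.
  by case: (i' == j); case: (j' == j); rewrite ?subrr ?subr0 ?sub0r ?normrN ?normr0 ?normr1.
have ex j : exists l, forall N, `|f j N - l| <= 3 * 1 * (2 / 3) ^+ N.
  apply: geometric_limit => N; have [c uE] := uS N; rewrite mul1r.
  rewrite /f uE /hextw foldl_rcons; apply: hext_range => i; exact: osc.
have [a ha] := choice ex; exists a.
have p0 N : 0 <= (2 / 3 : R) ^+ N by rewrite exprn_ge0//; lra.
split.
- move=> j; apply: (@le_geometric _ 3) => N.
  have := ha j N; rewrite mulr1 ler_norml => /andP[_ h2].
  have : 0 <= f j N by apply: hextw_ge0 => k; exact: ler0n.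
  by lra.
- apply: (@eq_geometric _ 9) => N; rewrite sum3.
  have := hextw_linear (u N) (fun=> 1 : R) i0; rewrite hextw_cst sum3 !mul1r => h1.
  have := ha i0 N; have := ha i1 N; have := ha i2 N; rewrite /f !ler_norml.
  move=> /andP[? ?] /andP[? ?] /andP[? ?].
  by apply/andP; split; lra.
- move=> h rh; pose e : R := \sum_j `|bval h w j|.
  have bnd j : `|bval h w j| <= e.
    by rewrite /e (bigD1 j)//= lerDl sumr_ge0.
  (* Replacing [x] by a vertex costs [2 * e], and each of the three weights costs [3 * e]. *)
  apply: (@eq_geometric _ (11 * e)) => N.
  have hx : `|h x - hextw (u N) (bval h w) i0| <= 2 * e * (2 / 3) ^+ N.
    rewrite -bval_cat //; apply: (@cell_range _ (w ++ u N)) => //.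
      exists (zs N); first exact: (uz N).1.
      by rewrite Fw_cat -(uz N).2.
    move=> j; rewrite bval_cat// -[in leRHS](su N); apply: hextw_osc => i' j'.
    rewrite (le_trans (ler_normB _ _))//.
    by have := bnd i'; have := bnd j'; lra.
  have hj j : `|bval h w j * f j N - a j * bval h w j| <= 3 * e * (2 / 3) ^+ N.
    rewrite mulrC -mulrBl normrM; have := ha j N; rewrite mulr1 => h1.
    rewrite (_ : 3 * e * _ = 3 * (2 / 3) ^+ N * e); last by ring.
    by rewrite ler_pM.
  move: hx (hj i0) (hj i1) (hj i2); rewrite hextw_linear !sum3 !ler_norml /f.
  move=> /andP[? ?] /andP[? ?] /andP[? ?] /andP[? ?].
  by apply/andP; split; lra.
Qed.

End regular.

(** * Integration over cut cells *)

Section measurability.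
Context {R : realType}.

(** The plane carries the product structure, so an open set is written as the countable union of the
    rational boxes it contains. *)
Lemma open_measurable_plane (U : set (R * R)) : open U -> measurable U.
Proof.
move=> oU; pose box (r : rat * rat * (rat * rat)) : set (R * R) :=
  `]ratr r.1.1, ratr r.1.2[%classic `*` `]ratr r.2.1, ratr r.2.2[%classic.
have -> : U = \bigcup_r (if `[< box r `<=` U >] then box r else set0).
  apply/seteqP; split => [x Ux|x [r _]]; last by case: asboolP => // h; exact: h.
  have /nbhs_ballP[e /= e0 eU] : nbhs x U by exact: open_nbhs_nbhs.
  have lt_e (y : R) : y - e < y /\ y < y + e by lra.
  have [a1] := rat_in_itvoo (lt_e x.1).1; have [b1] := rat_in_itvoo (lt_e x.1).2.
  have [a2] := rat_in_itvoo (lt_e x.2).1; have [b2] := rat_in_itvoo (lt_e x.2).2.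
  rewrite !in_itv /= => /andP[? ?] /andP[? ?] /andP[? ?] /andP[? ?].
  exists ((a1, b1), (a2, b2)) => //.
  case: asboolP => [_|]; first by split; rewrite /= in_itv /=; apply/andP; split.
  case; move=> y [] /=; rewrite !in_itv /= => /andP[? ?] /andP[? ?].
  apply: eU; split; rewrite -ball_normE /= ltr_norml; apply/andP; split; lra.
apply: countable_bigcupT_measurable => [|r]; first exact: countableP.
case: ifP => // _; apply: measurableX; exact: measurable_itv.
Qed.

Lemma compact_measurable_plane (A : set (R * R)) : compact A -> measurable A.
Proof.
move=> /(compact_closed (@norm_hausdorff _ _))/closed_openC.
by move=> /open_measurable_plane/measurableC; rewrite setCK.
Qed.

Lemma continuous_measurable_plane (A : set (R * R)) (h : R * R -> R) :
  measurable A -> {within A, continuous h} -> measurable_fun A h.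
Proof.
move=> mA /continuousP ch; apply: (measurability _ (measurable_realfun.RGenOpens.measurableE R)).
move=> _ [_ [a [b ->] <-]].
have /open_subspaceP[V oV VA] : open (h @^-1` `]a, b[%classic : set (subspace A)).
  by apply: ch; exact: interval_open.
by rewrite setIC -VA; apply: measurableI => //; exact: open_measurable_plane.
Qed.

End measurability.

(** Serves the error recursion for cuts: at each subdivision either piece [a] or both other pieces
    are exact, so at most two of three errors survive. *)
Lemma sum3_bound (R : realType) (X : 'I_3 -> R) (a : 'I_3) (y : R) :
  (forall c, `|X c| <= y) -> X a = 0 \/ (forall c, a != c -> X c = 0) ->
  `|\sum_c X c| <= 2 * y.
Proof.
move=> bX; rewrite sum3; move: (bX i0) (bX i1) (bX i2); rewrite !ler_norml.
move=> /andP[? ?] /andP[? ?] /andP[? ?] [|] Xa; apply/andP.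
  by move: Xa; elim/I3_ind: a; split; lra.
elim/I3_ind: a Xa => Xa.
- by have := Xa i1 isT; have := Xa i2 isT; split; lra.
- by have := Xa i0 isT; have := Xa i2 isT; split; lra.
- by have := Xa i0 isT; have := Xa i1 isT; split; lra.
Qed.

(** * Integrals of harmonic functions over cells and cuts *)

Section gasket_measure.
Context {R : realType}.
Implicit Types (z p : R * R) (w v u : seq 'I_3) (i j a c : 'I_3) (t : R).
Variables (q : 'I_3 -> R * R) (K : set (R * R)).
Variable mu : {measure set (R * R) -> \bar R}.
Hypotheses (qeq : equilateral q) (hK : is_SG q K) (hmu : selfsim q K mu).
Implicit Types (h : R * R -> R) (A B : set (R * R)).

Local Notation mass A := (fine (mu A)).
Local Notation J h A := (Rintegral mu A h).

Definition gsub A := measurable A /\ A `<=` K.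

Lemma gsub_cut a v t : gsub (cut q K a v t).
Proof.
split; first by apply: compact_measurable_plane; apply: cut_compact.
by move=> z /cut_sub_cell/(cell_sub hK).
Qed.

Lemma gsub_cell w : gsub (cell q K w).
Proof. by rewrite -(cut_le0 qeq hK i0 w (lexx 0)); exact: gsub_cut. Qed.

Lemma gsubK : gsub K.
Proof.
have := gsub_cell [::]; rewrite (_ : cell _ _ _ = K)//.
by apply/seteqP; split => [_ [z Kz <-]|z Kz] //; exists z.
Qed.

Lemma gsubU A B : gsub A -> gsub B -> gsub (A `|` B).
Proof.
move=> [mA sA] [mB sB]; split; first exact: measurableU.
by move=> z [/sA|/sB].
Qed.

Lemma gsubI A B : gsub A -> gsub B -> gsub (A `&` B).
Proof.
move=> [mA sA] [mB sB]; split; first exact: measurableI.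
by move=> z [/sA].
Qed.

Lemma gsubD A B : gsub A -> gsub B -> gsub (A `\` B).
Proof.
move=> [mA sA] [mB sB]; split; first exact: measurableD.
by move=> z [/sA].
Qed.

Lemma gsub_fin A : gsub A -> mu A \is a fin_num.
Proof.
move=> [mA sA]; have K1 : (mu K <= 1)%E.
  have := hmu.2 [::]; rewrite (_ : cell q K [::] = K) => [->|].
    by rewrite expr0 invr1.
  by apply/seteqP; split => [_ [z Kz <-]|z Kz] //; exists z.
rewrite ge0_fin_numE// (le_lt_trans _ (ltry 1))// (le_trans _ K1)//.
by apply: le_measure; rewrite ?inE//; exact: gsubK.1.
Qed.

Lemma massE A : gsub A -> mu A = (mass A)%:E.
Proof. by move=> gA; rewrite fineK// gsub_fin. Qed.

Lemma mass_ge0 A : 0 <= mass A. Proof. exact: fine_ge0. Qed.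

Lemma mass_cell w : mass (cell q K w) = 3 ^- size w.
Proof. by rewrite hmu.2. Qed.

Lemma mass_le A B : gsub A -> gsub B -> A `<=` B -> mass A <= mass B.
Proof.
move=> gA gB AB; rewrite -lee_fin -!massE//.
by apply: le_measure => //; rewrite inE; [exact: gA.1|exact: gB.1].
Qed.

Lemma mass_cst1 A : gsub A -> mass A = J (fun=> 1) A.
Proof. by move=> [mA _]; rewrite Rintegral_cst// mul1r. Qed.

Lemma regular_bounded h : regular q K h ->
  exists2 C : R, 0 <= C & forall z, K z -> `|h z| <= C.
Proof.
move=> rh; exists (\sum_j `|bval q h [::] j|); first by rewrite sumr_ge0.
move=> z Kz; rewrite -(subr0 (h z)); apply: (cell_range hK (w := [::]) rh).
  by exists z.
by move=> j; rewrite subr0 (bigD1 j)//= lerDl sumr_ge0.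
Qed.

Lemma regular_integrable h A : regular q K h -> gsub A ->
  mu.-integrable A (EFin \o h).
Proof.
move=> rh [mA sA]; apply: (integrableS gsubK.1 mA sA).
apply: measurable_bounded_integrable; first exact: gsubK.1.
- by rewrite massE ?ltry//; exact: gsubK.
- by apply: continuous_measurable_plane; [exact: gsubK.1|exact: rh.1].
have [C C0 hC] := regular_bounded rh; exists C; split; first exact: num_real.
by move=> x Cx z Kz; apply: le_trans (hC _ Kz) (ltW Cx).
Qed.

Lemma cst_integrable (x : R) A : gsub A -> mu.-integrable A (EFin \o (fun=> x)).
Proof. exact/regular_integrable/cst_regular. Qed.

Lemma J_mid h A (y e : R) : regular q K h -> gsub A ->
  (forall z, A z -> `|h z - y| <= e) -> `|J h A - y * mass A| <= e * mass A.
Proof.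
move=> rh gA hA; have mA := gA.1.
have ih := regular_integrable rh gA.
have := le_Rintegral mA (cst_integrable (y - e) gA) ih.
have := le_Rintegral mA ih (cst_integrable (y + e) gA).
rewrite !Rintegral_cst// => h1 h2.
have /h1{}h1 : forall z, A z -> h z <= y + e.
  by move=> z /hA; rewrite ler_norml => /andP[]; lra.
have /h2{}h2 : forall z, A z -> y - e <= h z.
  by move=> z /hA; rewrite ler_norml => /andP[]; lra.
by rewrite ler_norml; apply/andP; split; lra.
Qed.

Lemma J_le h (C : R) A : regular q K h -> (forall z, K z -> `|h z| <= C) ->
  gsub A -> `|J h A| <= C * mass A.
Proof.
move=> rh hC gA; rewrite -(subr0 (J h A)) -(mul0r (mass A)).
by apply: J_mid => // z /gA.2/hC; rewrite subr0.
Qed.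

Lemma J_null h A : regular q K h -> gsub A -> mass A = 0 -> J h A = 0.
Proof.
move=> rh gA A0; have [C _ hC] := regular_bounded rh.
by have := J_le rh hC gA; rewrite A0 mulr0 normr_le0 => /eqP.
Qed.

Lemma J_disjoint h A B : regular q K h -> gsub A -> gsub B -> A `&` B = set0 ->
  J h (A `|` B) = J h A + J h B.
Proof.
move=> rh gA gB AB; rewrite Rintegral_setU//; [exact: gA.1|exact: gB.1| |].
  by apply: regular_integrable => //; exact: gsubU.
by apply/disj_setPS; rewrite AB.
Qed.

(** A null overlap contributes nothing, so [B] can be replaced by its part outside [A]. *)
Lemma J_setU h A B : regular q K h -> gsub A -> gsub B -> mass (A `&` B) = 0 ->
  J h (A `|` B) = J h A + J h B.
Proof.
move=> rh gA gB AB; have gBA := gsubD gB gA; have gI := gsubI gA gB.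
rewrite (_ : A `|` B = A `|` (B `\` A)); last first.
  apply/seteqP; split => z; last by case=> [|[]]; [left|right].
  by case=> [Az|Bz]; [left|have [Az|nAz] := pselect (A z); [left|right]].
have dis : A `&` (B `\` A) = set0 by rewrite setDE setICA setICr setI0.
rewrite J_disjoint//; congr (_ + _).
have {2}-> : B = (B `\` A) `|` (A `&` B) by rewrite setIC setUC setUIDK.
rewrite J_disjoint// ?(J_null rh gI AB) ?addr0//.
by apply/seteqP; split => // z [[_ nAz] [Az _]].
Qed.

Lemma mass_setU A B : gsub A -> gsub B ->
  mass (A `|` B) = mass A + mass B - mass (A `&` B).
Proof.
move=> gA gB; have gU := gsubU gA gB; have gI := gsubI gA gB.
have muB : (mu B < +oo)%E by rewrite massE ?ltry.
apply: EFin_inj; rewrite -massE// EFinB EFinD -!massE//.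
by rewrite (measureUfinr gA.1 gB.1 muB).
Qed.

(* The three subcells of a cell have a third of its mass each, which leaves no
   room for an overlap of positive mass. *)
Lemma overlap_rcons v a c : a != c ->
  mass (cell q K (rcons v a) `&` cell q K (rcons v c)) = 0.
Proof.
move=> ac; have gc w := gsub_cell w; have gi w u := gsubI (gc w) (gc u).
have vE := mass_cell v; have sE d := mass_cell (rcons v d).
have {}sE d : mass (cell q K (rcons v d)) = 3 ^- size v / 3.
  by rewrite sE size_rcons exprS invfM mulrC.
have key d e f : cell q K v `<=`
    cell q K (rcons v d) `|` cell q K (rcons v e) `|` cell q K (rcons v f) ->
    mass (cell q K (rcons v d) `&` cell q K (rcons v e)) = 0.
  move=> sub; have gU := gsubU (gc (rcons v d)) (gc (rcons v e)).
  have := mass_le (gc v) (gsubU gU (gc (rcons v f))) sub.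
  rewrite mass_setU// (mass_setU (gc _) (gc _)) !sE vE.
  have := mass_ge0 ((cell q K (rcons v d) `|` cell q K (rcons v e)) `&`
    cell q K (rcons v f)).
  have := mass_ge0 (cell q K (rcons v d) `&` cell q K (rcons v e)).
  by set x := 3 ^- size v; lra.
have sub d e f : [set: 'I_3] `<=` [set d; e; f] -> cell q K v `<=`
    cell q K (rcons v d) `|` cell q K (rcons v e) `|` cell q K (rcons v f).
  move=> all z; rewrite cell_split => // h.
  have [k kz] : exists k, cell q K (rcons v k) z.
    by case: h => [?|[?|?]]; [exists i0|exists i1|exists i2].
  by case: (all k I) kz => [[->|->]|->]; [left; left|left; right|right].
have [f fa] : exists f, [set: 'I_3] `<=` [set a; c; f].
  by elim/I3_ind: a ac; elim/I3_ind: c => //= _; [exists i2|exists i1|exists i2|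
    exists i0|exists i1|exists i0]; elim/I3_ind=> _ /=; tauto.
exact: key (sub _ _ _ fa).
Qed.

(** At the first differing letter the two cells fall into different children of one cell, whose
    overlap is null. *)
Lemma overlap w v : size w = size v -> w != v ->
  mass (cell q K w `&` cell q K v) = 0.
Proof.
move=> swv wv.
have [u [a [c [w' [v' [-> -> ac]]]]]] : exists u a c w' v',
    [/\ w = rcons u a ++ w', v = rcons u c ++ v' & a != c].
  elim: w v swv wv => [|a w IH] [|c v] //= [] swv wv.
  have [ac|ac] := eqVneq a c; last by exists [::], a, c, w, v.
  have [|u [a' [c' [w' [v' [-> -> h]]]]]] := IH v swv.
    by apply: contra wv => /eqP->; rewrite ac.
  by exists (a :: u), a', c', w', v'; rewrite -ac.
apply/eqP; rewrite eq_le mass_ge0 andbT -(overlap_rcons u ac).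
apply: mass_le; try (apply: gsubI; exact: gsub_cell).
by move=> z [/(cell_cat hK) ? /(cell_cat hK) ?].
Qed.

Lemma overlap_sub w v A B : size w = size v -> w != v -> gsub A -> gsub B ->
  A `<=` cell q K w -> B `<=` cell q K v -> mass (A `&` B) = 0.
Proof.
move=> swv wv gA gB Aw Bv; apply/eqP; rewrite eq_le mass_ge0 andbT.
rewrite -(overlap swv wv); apply: mass_le; [exact: gsubI| |].
  by apply: gsubI; exact: gsub_cell.
by move=> z [/Aw ? /Bv ?].
Qed.

Lemma J_three h (A : 'I_3 -> set (R * R)) (w : 'I_3 -> seq 'I_3) :
  regular q K h -> injective w -> (forall c d, size (w c) = size (w d)) ->
  (forall c, gsub (A c)) -> (forall c, A c `<=` cell q K (w c)) ->
  J h (A i0 `|` (A i1 `|` A i2)) = \sum_c J h (A c).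
Proof.
move=> rh wi sw gA Aw; rewrite sum3 -addrA.
have ov c d : c != d -> mass (A c `&` A d) = 0.
  move=> cd; apply: (overlap_sub (sw c d)) => //.
  by apply: contra cd => /eqP/wi ->.
rewrite J_setU//; [rewrite J_setU//; [exact: ov]|exact: gsubU|].
rewrite setIUr mass_setU ?ov// ?add0r; try exact: gsubI.
apply/eqP; rewrite oppr_eq0 eq_le mass_ge0 andbT -(ov i0 i1 isT).
by apply: mass_le; [apply: gsubI; exact: gsubI|exact: gsubI|move=> z []].
Qed.

Lemma J_cut_split h a v t : regular q K h ->
  J h (cut q K a v t) = \sum_c J h (cut q K a (rcons v c) (2 * t - (a == c)%:R)).
Proof.
move=> rh; rewrite (cut_split qeq hK a v t).
apply: (J_three (A := fun c => cut q K a (rcons v c) (2 * t - (a == c)%:R))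
  (w := rcons v)) => //.
- exact: rcons_injr.
- by move=> c d; rewrite !size_rcons.
- by move=> c; exact: gsub_cut.
- by move=> c; exact: cut_sub_cell.
Qed.

(** The formula is preserved by subdivision, as the three midpoint values have the same sum as the
    boundary values. Its error is at most oscillation times mass, and subdividing shrinks the
    oscillation. *)
Lemma J_cell h v : regular q K h ->
  J h (cell q K v) = 3 ^- size v * ((\sum_j bval q h v j) / 3).
Proof.
move=> rh; have [C C0 hC] := regular_bounded rh.
have bC u j : `|bval q h u j| <= C.
  by apply: hC; apply: (cell_sub hK); exact: cell_vertex.
have key N u (e : R) : (forall i j, `|bval q h u i - bval q h u j| <= e) ->
    `|J h (cell q K u) - 3 ^- size u * ((\sum_j bval q h u j) / 3)| <=
    e * 3 ^- size u * (2 / 3) ^+ N.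
  elim: N u e => [|N IH] u e he.
    rewrite mulr1 mulrC -mass_cell; apply: J_mid => //; first exact: gsub_cell.
    move=> z uz; apply: (cell_range hK rh uz) => j.
    move: (he i0 i1) (he i0 i2) (he i1 i2); rewrite sum3 !ler_norml.
    move=> /andP[? ?] /andP[? ?] /andP[? ?]; apply/andP.
    by elim/I3_ind: j; split; lra.
  rewrite -(cut_le0 qeq hK i0 u (lexx 0)) J_cut_split// !sum3.
  have neg c : cut q K i0 (rcons u c) (2 * 0 - (i0 == c)%:R) =
      cell q K (rcons u c).
    by apply: (cut_le0 qeq hK); case: (_ == _) => /=; lra.
  have hb c i j : `|bval q h (rcons u c) i - bval q h (rcons u c) j| <=
      e * (2 / 3) by rewrite !rh.2; exact: hext_osc.
  have := IH _ _ (hb i0); have := IH _ _ (hb i1); have := IH _ _ (hb i2).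
  rewrite !neg !size_rcons !sum3 !rh.2 /hext /= !sum3 !exprS !invfM.
  set x := 3 ^- size u; set y := (2 / 3) ^+ N.
  rewrite !ler_norml => /andP[? ?] /andP[? ?] /andP[? ?].
  by apply/andP; split; lra.
have he i j : `|bval q h v i - bval q h v j| <= 2 * C.
  rewrite (le_trans (ler_normB _ _))//.
  by have := bC v i; have := bC v j; lra.
by apply: eq_geometric => N; exact: key.
Qed.

(** Both sides obey the same subdivision rule and agree for thresholds at most 0 or above 1. At most
    two of the three pieces escape these cases, each with a third of the mass, so the error
    contracts by 2/3. *)
Lemma J_cut h m n a v t : cut_profile m n -> regular q K h ->
  J h (cut q K a v t) = 3 ^- size v *
    ((m t - 3 * n t) * bval q h v a + n t * \sum_j bval q h v j).
Proof.
move=> P rh; have [C C0 hC] := regular_bounded rh.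
pose F u s := 3 ^- size u *
  ((m s - 3 * n s) * bval q h u a + n s * \sum_j bval q h u j).
have p3 u : 0 < 3 ^- size u :> R by rewrite invr_gt0 exprn_gt0.
have bC u j : `|bval q h u j| <= C.
  by apply: hC; apply: (cell_sub hK); exact: cell_vertex.
have le0 u s : s <= 0 -> J h (cut q K a u s) = F u s.
  move=> s0; rewrite (cut_le0 qeq hK)// J_cell// /F (cut_m_le0 P)//.
  by rewrite (cut_n_le0 P)//; set x := 3 ^- size u; lra.
(* Strict, since at [s = 1] the cut still contains a vertex. *)
have gt1 u s : 1 < s -> J h (cut q K a u s) = F u s.
  move=> s1; rewrite (cut_gt1 qeq hK)// Rintegral_set0 /F.
  by rewrite (cut_m_ge1 P (ltW s1)) (cut_n_ge1 P (ltW s1)); lra.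
have Fsplit u s : F u s = \sum_c F (rcons u c) (2 * s - (a == c)%:R).
  rewrite sum3 /F !size_rcons !sum3 !rh.2 /hext /= !sum3 exprS invfM.
  rewrite [m s](cut_mE P) [n s](cut_nE P); set x := 3 ^- size u.
  by clear F le0 gt1; elim/I3_ind: a; rewrite /= ?subr0; field.
have key N u s : `|J h (cut q K a u s) - F u s| <=
    9 * C * 3 ^- size u * (2 / 3) ^+ N.
  elim: N u s => [|N IH] u s.
    have nn : 0 <= 9 * C * 3 ^- size u by rewrite !mulr_ge0// ltW.
    rewrite mulr1; have gc := gsub_cut a u s.
    have [s0|s0] := lerP s 0; first by rewrite le0// subrr normr0.
    have [s1|s1] := ltrP 1 s; first by rewrite gt1// subrr normr0.
    have h1 : `|J h (cut q K a u s)| <= C * 3 ^- size u.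
      rewrite (le_trans (J_le rh hC gc))// ler_wpM2l// -mass_cell.
      by apply: mass_le => //; [exact: gsub_cell|exact: cut_sub_cell].
    (* Here [m] lies in [0, 1] and [n] in [0, 1/3], so [m - 3 * n] lies in [-1, 1]. *)
    have h2 : `|F u s| <= 3 ^- size u * (1 * C + 3^-1 * (3 * C)).
      rewrite /F normrM (ger0_norm (ltW (p3 u))) ler_wpM2l ?(ltW (p3 u))//.
      have := cut_m_anti P (ltW s0); have := cut_m_anti P s1.
      have := cut_n_anti P (ltW s0); have := cut_n_anti P s1.
      rewrite (cut_m_le0 P (lexx _)) (cut_n_le0 P (lexx _)).
      rewrite (cut_m_ge1 P (lexx _)) (cut_n_ge1 P (lexx _)) => ? ? ? ?.
      rewrite (le_trans (ler_normD _ _))// lerD// normrM ler_pM//.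
      - by rewrite ler_norml; apply/andP; split; lra.
      - by rewrite ger0_norm.
      rewrite sum3 (le_trans (ler_normD _ _))//.
      have := ler_normD (bval q h u i0) (bval q h u i1).
      by have := bC u i0; have := bC u i1; have := bC u i2; lra.
    by rewrite (le_trans (ler_normB _ _))//; lra.
  rewrite J_cut_split// Fsplit -sumrB.
  pose X c := J h (cut q K a (rcons u c) (2 * s - (a == c)%:R)) -
    F (rcons u c) (2 * s - (a == c)%:R).
  pose y := 9 * C * 3 ^- size u * (2 / 3) ^+ N / 3.
  have bX c : `|X c| <= y.
    have := IH (rcons u c) (2 * s - (a == c)%:R).
    rewrite -/(X c) size_rcons exprS invfM => /le_trans; apply.
    by rewrite /y; set x := 3 ^- size u; lra.
  have -> : 9 * C * 3 ^- size u * (2 / 3) ^+ N.+1 = 2 * y.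
    by rewrite /y exprS; set x := 3 ^- size u; lra.
  apply: (sum3_bound (a := a) bX).
  have [s2|s2] := lerP s (2^-1).
    by left; rewrite /X le0 ?subrr// eqxx /=; lra.
  by right => c ac; rewrite /X gt1 ?subrr// (negPf ac) /=; lra.
by apply: eq_geometric => N; exact: key.
Qed.

End gasket_measure.

(** * Mean value neighborhoods *)

Section mean_value_neighborhood.
Context {R : realType}.
Implicit Types (z p : R * R) (w v u : seq 'I_3) (i j a c : 'I_3) (t : R).
Variables (q : 'I_3 -> R * R) (K : set (R * R)).
Variable mu : {measure set (R * R) -> \bar R}.
Hypotheses (qeq : equilateral q) (hK : is_SG q K) (hmu : selfsim q K mu).
Implicit Types (h : R * R -> R) (A B : set (R * R)).

Local Notation mass A := (fine (mu A)).
Local Notation J h A := (Rintegral mu A h).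

Lemma not_nseq w i : w <> nseq (size w) i ->
  exists u a r, a != i /\ w = u ++ a :: nseq r i.
Proof.
elim/last_ind: w => [//|w c IH] wi; have [ci|ci] := eqVneq c i; last first.
  by exists w, c, 0%N; rewrite cats1.
have [|u [a [r [ai wE]]]] := IH.
  move=> wE; apply: wi; rewrite size_rcons ci wE size_nseq.
  by rewrite -cats1 -[[:: i]]/(nseq 1 i) -nseqD addn1.
exists u, a, r.+1; split => //.
by rewrite wE rcons_cat rcons_cons ci -cats1 -[[:: i]]/(nseq 1 i) -nseqD addn1.
Qed.

(* If [w = u a i ... i] with [a != i], then the other cell at [F_w q_i] is the
   one of [u i a ... a], which has that point as its vertex number [a]. *)
Lemma neighbor_cells w : (forall j, w <> nseq (size w) j) ->
  exists (v : 'I_3 -> seq 'I_3) (a : 'I_3 -> 'I_3), [/\ injective v,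
    forall i, size (v i) = size w, forall i, v i != w &
    forall i, Fw q (v i) (q (a i)) = Fw q w (q i)].
Proof.
move=> wn.
have ex i : exists va : seq 'I_3 * 'I_3, [/\ size va.1 = size w, va.1 != w &
    Fw q va.1 (q va.2) = Fw q w (q i)].
  have [u [a [r [ai ->]]]] := not_nseq (@wn i).
  exists (u ++ i :: nseq r a, a); split => /=.
  - by rewrite !size_cat /= !size_nseq.
  - by rewrite eqseq_cat// eqxx /= eqseq_cons eq_sym (negPf ai).
  - by rewrite !Fw_cat /= !Fw_nseq; congr (Fw q u _); exact: midptC.
have [va hva] := choice ex; exists (fun i => (va i).1), (fun i => (va i).2).
split; [|by move=> i; case: (hva i)..].
move=> i j vij; have [si wi ei] := hva i; have [sj wj ej] := hva j.
apply: (Fw_common_vertex2 qeq (esym si) _ (esym ei)); first by rewrite eq_sym.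
by rewrite -ej vij.
Qed.

(** Harmonicity at the junction point trades the boundary values of the neighbor for those of the
    cell. *)
Lemma neighbor_sum h w v i a : Defs.harmonic q K h -> size v = size w ->
  v != w -> Fw q v (q a) = Fw q w (q i) -> ~ range q (Fw q w (q i)) ->
  (0 < size w)%N ->
  \sum_k bval q h v k = 6 * bval q h w i - \sum_k bval q h w k.
Proof.
move=> [_ hh] svw vw e nV w0.
have := hh _ w0 (Fw q w (q i)); rewrite eq_sym in vw.
rewrite (sum_neighbors qeq h (esym svw) vw (esym e)).
have Vx : Vm q (size w) (Fw q w (q i)) by exists (in_tuple w), i.
move=> /(_ Vx nV); rewrite -/(bval q h w i).
rewrite -[\sum_k h (Fw q w (q k))]/(\sum_k bval q h w k).
rewrite -[\sum_k h (Fw q v (q k))]/(\sum_k bval q h v k).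
by lra.
Qed.

Lemma mass_setIU0 A B C : gsub K A -> gsub K B -> gsub K C ->
  mass (A `&` B) = 0 -> mass (A `&` C) = 0 -> mass (A `&` (B `|` C)) = 0.
Proof.
move=> gA gB gC AB AC; have gAB := gsubI gA gB; have gAC := gsubI gA gC.
apply/eqP; rewrite eq_le mass_ge0 andbT setIUr.
rewrite (mass_setU qeq hK hmu gAB gAC) AB AC add0r sub0r oppr_le0.
exact: mass_ge0.
Qed.

Lemma J_union h w (v : 'I_3 -> seq 'I_3) (E : 'I_3 -> set (R * R)) :
  regular q K h -> injective v -> (forall i, size (v i) = size w) ->
  (forall i, v i != w) -> (forall i, gsub K (E i)) ->
  (forall i, E i `<=` cell q K (v i)) ->
  J h (cell q K w `|` (E i0 `|` (E i1 `|` E i2))) =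
  J h (cell q K w) + \sum_i J h (E i).
Proof.
move=> rh vi sv vw gE Ev; have gw := gsub_cell qeq hK w.
have ov i : mass (cell q K w `&` E i) = 0.
  by apply: (overlap_sub qeq hK hmu (esym (sv i))) => //; rewrite eq_sym.
have gU : gsub K (E i1 `|` E i2) by exact: gsubU.
rewrite (J_setU qeq hK hmu rh gw); [|exact: gsubU|]; last first.
  by do ! apply: mass_setIU0.
by congr (_ + _); apply: (J_three qeq hK hmu rh vi) => // i j; rewrite !sv.
Qed.

(** The last clause, that [B] stays in cells of the same level meeting that of [w], serves to bound
    the distance from [x] to points of [B]. *)
Lemma mean_value_neighborhood w x : cell q K w x ->
  cell q K w `&` range q = set0 ->
  exists B, [/\ is_MVN q K mu x (size w) B, B x &
    forall y, B y -> exists2 v, size v = size w &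
      exists p, [/\ cell q K w p, cell q K v p & cell q K v y]].
Proof.
move=> wx wV.
have nV p : cell q K w p -> ~ range q p.
  by move=> wp Vp; have : set0 p by rewrite -wV.
(* A constant word names a corner cell; excluding it provides a neighbor at each vertex. *)
have wn j : w <> nseq (size w) j.
  move=> wE; apply: (nV (q j)); last by exists j.
  by rewrite -[in X in cell _ _ _ X](Fw_nseq q (size w) j) -wE; exact: cell_vertex.
have w0 : (0 < size w)%N by case: (w) (wn i0).
have [v [b [vi sv vw vb]]] := neighbor_cells wn.
have [m [n P]] := @cut_profile_exists R.
have [a [a0 a1 ax]] := cell_weights hK wx.
have [t [S [t01 SE gE]]] := cut_solve P a0 a1.
pose c i := 1 - t i; pose E i := cut q K (b i) (v i) (t i).
have EE i : Ecut q K w (v i) i (c i) = E i.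
  by rewrite (Ecut_cut _ qeq _ (sv i) (vb i)) /c subKr.
have BE : Bset q K w v c = cell q K w `|` (E i0 `|` (E i1 `|` E i2)).
  rewrite /Bset; congr (_ `|` _); apply/seteqP; split => [z [i _]|z].
    by rewrite EE; elim/I3_ind: i; [left|right; left|right; right].
  by rewrite -!EE => -[|[]] ?; [exists i0|exists i1|exists i2].
have gE' i : gsub K (E i) by apply: gsub_cut.
have Ev i : E i `<=` cell q K (v i) by exact: cut_sub_cell.
have gB : gsub K (Bset q K w v c).
  by rewrite BE; apply: gsubU; [exact: gsub_cell|do ! apply: gsubU].
have m0 i : 0 <= m (t i).
  have /andP[_ h] := t01 i.
  by have := cut_m_anti P h; rewrite (cut_m_ge1 P (lexx _)).
have S0 : 0 < S by rewrite SE ltr_wpDr// sumr_ge0.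
pose r : R := 3 ^- size w; have r0 : 0 < r by rewrite invr_gt0 exprn_gt0.
(* The mass is the integral of the constant 1, for which the cut formula reduces to [m (t i)]. *)
have massB : mass (Bset q K w v c) = r * S.
  rewrite (mass_cst1 _ gB) BE.
  have r1 := cst_regular q K (1 : R).
  rewrite (J_union r1 vi)// (J_cell qeq hK hmu w r1) -/r SE !sum3.
  by rewrite !(J_cut qeq hK hmu _ _ _ P r1) !sv -/r !sum3 /bval; field.
have JB h : Defs.harmonic q K h -> J h (Bset q K w v c) = r * S * h x.
  move=> hh; have rh := harmonic_regular qeq hh.
  rewrite BE (J_union rh vi)// (J_cell qeq hK hmu w rh) -/r (ax h rh).
  (* Trading the neighbor's sum turns the coefficient [m - 3 * n] into [m + 3 * n], which is
     [a i * S] by the choice of [t]. *)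
  have Jc i : J h (E i) = r * (a i * S * bval q h w i -
      n (t i) * \sum_k bval q h w k).
    rewrite (J_cut qeq hK hmu _ _ _ P rh) sv -/r -gE.
    rewrite (neighbor_sum hh (sv i) (vw i) (vb i))//; last first.
      by apply: nV; exact: cell_vertex.
    have -> : bval q h (v i) (b i) = bval q h w i by rewrite /bval vb.
    by ring.
  have n1 : n (t i0) + n (t i1) + n (t i2) = 3^-1.
    have := gE i0; have := gE i1; have := gE i2; move: a1 SE; rewrite !sum3.
    move=> a1 SE; have : (a i0 + a i1 + a i2) * S = S by rewrite a1 mul1r.
    by lra.
  rewrite (eq_bigr _ (fun i _ => Jc i)); set X := \sum_j bval q h w j.
  rewrite !(sum3 (fun i => _ * _)).
  have -> : X / 3 = (n (t i0) + n (t i1) + n (t i2)) * X by rewrite n1 mulrC.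
  by ring.
exists (Bset q K w v c); split.
- exists w; split => //; exists v, c; split => //.
  + by move=> i; split => //; rewrite -vb; exact: cell_vertex.
  + by move=> i; have := t01 i; rewrite /c; lra.
  + move=> h hh; rewrite /mean -[fine (\int[mu]_(z in _) _)%E]/(J h _).
    by rewrite JB// massB mulrC mulKf// mulf_neq0// gt_eqF.
- by left.
- move=> y; rewrite BE => -[wy|yE].
    by exists w => //; exists y.
  have [i yi] : exists i, E i y.
    by case: yE => [?|[?|?]]; [exists i0|exists i1|exists i2].
  exists (v i) => //; exists (Fw q w (q i)); split; last exact: Ev yi.
    exact: cell_vertex.
  by rewrite -vb; exact: cell_vertex.
Qed.

End mean_value_neighborhood.

(** * Neighborhoods shrinking to the point *)

Theorem theorem3p2 (R : realType) (q : 'I_3 -> R * R) (K : set (R * R))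
  (mu : {measure set (R * R) -> \bar R}) :
  equilateral q -> is_SG q K -> selfsim q K mu ->
  forall x : R * R, K x -> ~ range q x ->
  exists k0 : nat, (1 <= k0)%N /\
    exists B : nat -> set (R * R),
      (forall k : nat, (k0 <= k)%N -> is_MVN q K mu x k (B k)) /\
      \bigcap_(k in [set k : nat | (k0 <= k)%N]) B k = [set x].
Proof.
move=> qeq hK hmu x Kx xV.
have [D D0 hD] := cell_diam hK.
(* The distance to the nearest corner: a cell around [x] of smaller diameter contains no corner. *)
have [d d0 hd] : exists2 d : R, 0 < d & forall j, d <= `|x - q j|.
  exists (Num.min `|x - q i0| (Num.min `|x - q i1| `|x - q i2|)).
    have pos j : 0 < `|x - q j|.
      by rewrite normr_gt0 subr_eq0; apply/eqP => xq; apply: xV; exists j.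
    by rewrite !lt_min !pos.
  by elim/I3_ind; rewrite !ge_min lexx ?orbT.
have pow_le M k : (M <= k)%N -> (2 / 3 : R) ^+ k <= (2 / 3) ^+ M.
  by move=> Mk; rewrite ler_wiXn2l//; lra.
have [N hN] := geometric_small D d0.
(* Level [N] is already fine enough; the successor only ensures a starting level of at least 1. *)
exists N.+1; split => //.
have ex k : exists B : set (R * R), (N.+1 <= k)%N -> [/\ is_MVN q K mu x k B,
    B x & forall y, B y -> `|x - y| <= 2 * D * (2 / 3) ^+ k].
  (* Below the starting level any set will do. *)
  have [Nk|_] := leqP N.+1 k; last by exists set0.
  have [w sw wx] := cell_level hK k Kx.
  have wV : cell q K w `&` range q = set0.
    apply/seteqP; split => // p [wp [j _ jp]].
    have := hD _ _ _ wx wp; rewrite -jp sw => h1.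
    have := pow_le N k (ltnW Nk); rewrite -(ler_pM2l D0) => h2.
    by have := hd j; lra.
  have [B [BM Bx hB]] := mean_value_neighborhood qeq hK hmu wx wV.
  exists B => _; split => //; first by rewrite -sw.
  move=> y /hB[v sv [p [wp vp vy]]].
  (* Passing through the common point [p] of the two cells costs two cell diameters. *)
  rewrite (le_trans (ler_distD p x y))//.
  have := hD _ _ _ wx wp; have := hD _ _ _ vp vy; rewrite sv sw.
  by lra.
have [B hB] := choice ex; exists B; split; first by move=> k /hB[].
apply/seteqP; split => [y yB|_ -> k /hB[]//].
apply/eqP; rewrite eq_sym -subr_eq0 -normr_le0.
apply: (@le_geometric _ (2 * D)) => M; rewrite add0r.
have Nk : (N.+1 <= N.+1 + M)%N by rewrite leq_addr.
have [_ _ h] := hB _ Nk; rewrite (le_trans (h _ (yB _ Nk)))//.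
by rewrite ler_wpM2l ?mulr_ge0 ?(ltW D0)// pow_le// leq_addl.
Qed.
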